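(* There exists an absolute constant $c_0'>0$ such that the following holds. Let $n\ge2$, let $\mu_1,\dots,\mu_n>0$, $D_\mu=\mathrm{diag}(\mu_1,\dots,\mu_n)$, and suppose Assumption 2 (context) holds with constant $c_0'$. Let $X\in\mathbb{C}^{n\times n}$ be a random Hermitian matrix such that $\{\Re(X_{jk}),\Im(X_{jk})\}_{1\le j\le k\le n}$ are jointly independent, centered, with $\|\Re(X_{jk})\|_{\psi_2}\le1$, $\|\Im(X_{jk})\|_{\psi_2}\le1$. Let $\tau\in[0,1]$ be fixed and let $g\in\mathbb{C}^n$ be a random vector, independent of $X$, whose real and imaginary parts of entries are jointly independent subgaussian with $\|\Re(g_j)\|_{\psi_2}\le1$, $\|\Im(g_j)\|_{\psi_2}\le1$. Then with probability $1-O(n^{-4})$, $$z^*Xz+\tau\|z\|_2\Re(g^*z)\le z^*D_\mu z\qquad\text{for all }z\in\mathbb{C}^n.$$ In particular $X\preceq D_\mu$ with probability $1-O(n^{-4})$.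
   Context: $\|\xi\|_{\psi_2}:=\sup_{q\ge1}q^{-1/2}(\mathbb{E}|\xi|^q)^{1/q}$. $\mathrm{ddiag}(D_\mu^{-1})\in\mathbb{R}^n$ is the vector $(\mu_1^{-1},\dots,\mu_n^{-1})$. For $p\in[2,\infty)$, $\|\cdot\|_{p/(p-2)}$ means $\|\cdot\|_\infty$ when $p=2$. Assumption 2 (with constant $c_0'$): either (1) there exists $p\in[2,\infty)$ with $\sqrt{p\log n}\,n^{1/p}\|\mathrm{ddiag}(D_\mu^{-1})\|_{p/(p-2)}\le c_0'$, or (2) $\log n\,\|\mathrm{ddiag}(D_\mu^{-1})\|_1\le c_0'$. $X\preceq D_\mu$ means $D_\mu-X$ is positive semidefinite. *)

(* Defs.v *)
From HB Require Import structures.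
From mathcomp Require Import all_boot all_order all_algebra.
From mathcomp Require Import all_classical all_reals all_analysis.
From mathcomp Require Import complex spectral.
Set Implicit Arguments. Unset Strict Implicit. Unset Printing Implicit Defensive.
Import Order.TTheory GRing.Theory Num.Theory.
Local Open Scope ring_scope.
Local Open Scope classical_set_scope.
Local Open Scope sesquilinear_scope.

Definition ctr (R : realType) m n (M : 'M[R[i]]_(m, n)) : 'M[R[i]]_(n, m) :=
  M ^t (@conjc R).

Definition sesq (R : realType) n (u : 'cV[R[i]]_n) (M : 'M[R[i]]_n)
  (v : 'cV[R[i]]_n) : R[i] := (ctr u *m M *m v) 0 0.

Definition norm2 (R : realType) n (z : 'cV[R[i]]_n) : R :=
  Num.sqrt (\sum_i ((complex.Re (z i 0)) ^+ 2 + (complex.Im (z i 0)) ^+ 2)).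

Definition Dmu (R : realType) n (mu : 'I_n -> R) : 'M[R[i]]_n :=
  diag_mx (\row_i ((mu i)%:C)%C).

Definition is_hermitian (R : realType) n (A : 'M[R[i]]_n) : Prop := ctr A = A.

Definition psdmx (R : realType) n (A : 'M[R[i]]_n) : Prop :=
  forall z : 'cV[R[i]]_n, 0 <= sesq z A z.

Definition loewner_le (R : realType) n (X D : 'M[R[i]]_n) : Prop := psdmx (D - X).

Definition ddiag_inv (R : realType) n (mu : 'I_n -> R) : 'I_n -> R :=
  fun i => (mu i)^-1.

Definition linf_norm (R : realType) n (v : 'I_n -> R) : R := \big[Num.max/0]_i `|v i|.
Definition lr_norm (R : realType) n (r : R) (v : 'I_n -> R) : R :=
  (\sum_i `|v i| `^ r) `^ r^-1.

Definition norm_pp2 (R : realType) n (p : R) (v : 'I_n -> R) : R :=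
  if p == 2 then linf_norm v else lr_norm (p / (p - 2)) v.

Definition assumption2 (R : realType) n (c0' : R) (mu : 'I_n -> R) : Prop :=
  (exists p : R, 2 <= p /\
     Num.sqrt (p * ln (n%:R)) * (n%:R `^ p^-1) * norm_pp2 p (ddiag_inv mu) <= c0')
  \/ ln (n%:R) * lr_norm 1 (ddiag_inv mu) <= c0'.

Definition psi2norm d (T : measurableType d) (R : realType) (P : probability T R)
  (xi : T -> R) : \bar R :=
  ereal_sup [set ((q `^ (- 2^-1))%:E * poweR ('E_P[fun w => (`|xi w| `^ q)%R])%E q^-1)%E
            | q in [set q : R | 1 <= q]].

Definition mutually_independent d (T : measurableType d) (R : realType)
  (P : probability T R) (I : finType) (D : {pred I}) (F : I -> T -> R) : Prop :=
  forall B : I -> set R, (forall i, measurable (B i)) ->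
    P [set w | forall i, i \in D -> B i (F i w)] =
    (\prod_(i in D) P (F i @^-1` B i))%E.

Definition independent_families d (T : measurableType d) (R : realType)
  (P : probability T R) (I J : finType) (F : I -> T -> R) (G : J -> T -> R) : Prop :=
  forall (A : I -> set R) (B : J -> set R),
    (forall i, measurable (A i)) -> (forall j, measurable (B j)) ->
    P ([set w | forall i, A i (F i w)] `&` [set w | forall j, B j (G j w)]) =
    (P [set w | forall i, A i (F i w)] * P [set w | forall j, B j (G j w)])%E.

(* Main.v *)
(** With w_j = 1/mu_j, both alternatives of Assumption 2 yield
    log n * max w * sum w <= (2 c0')^2, and only this is used.  The linear term
    is then controlled by a maximal inequality for the entries of g and the
    Cauchy-Schwarz inequality.

    In real coordinates the Hermitian form is a sum of four bilinear forms
    sum xi_jk x_j y_k whose coefficients are jointly subgaussian.  The indices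
    are split into dyadic levels of w.  On a pair of levels with s and t elements
    the vectors are rounded to integer lattices, each coordinate in the direction
    that does not decrease the form, and one exponential moment, summed over all
    lattice points with summable weights, bounds the form by
    sqrt (s + t + log n) |x| |y| up to a constant.  Since w decays geometrically
    over the levels, Cauchy-Schwarz bounds the total by
    (sqrt (max w * sum w) + sqrt (log n) max w) |x|_mu |y|_mu up to a constant.
    A single application of Markov's inequality, to the sum of all the
    exponential moments, produces the good event. *)
Require Import Defs.
From HB Require Import structures.
From mathcomp Require Import all_boot all_order all_algebra.
From mathcomp Require Import all_classical all_reals all_analysis.
From mathcomp Require Import complex spectral.
From mathcomp Require Import measurable_realfun ring lra.
Import Order.TTheory GRing.Theory Num.Theory HBNNSimple.
Local Open Scope ring_scope.
Local Open Scope classical_set_scope.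

(** * Expectations of products of independent variables *)

(** The obstacle is that the weights may differ widely. One net for all coordinates pays
    [sqrt (n + log n) * max w], while the budget controls only [max w * sum w]; a single large
    weight already breaks that estimate. On a dyadic level [w] is constant up to a factor 2, so the
    cardinality of the level times its weight is comparable with its share of [sum w]. Rounding in a
    favourable direction is possible because the form is linear in each vector separately: no
    approximation error has to be absorbed, only the norms grow by a constant factor. By homogeneity
    a vector on a level with s elements is first scaled to norm [sqrt s], the size at which points
    of the unit lattice cost a factor exponential in s, so one exponential rate per pair of levels
    serves all vectors. The exponent 4 comes from n^2 nonnegative variables of expectation at most
    6, compared with the threshold n^6. Half of the form of [D_mu] is reserved for the quadratic
    term and half for the linear one. *)

Lemma integral_indic_preimage d (T : measurableType d) (R : realType)
    (P : probability T R) (xi : T -> R) (B : set R) :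
  measurable_fun setT xi -> measurable B ->
  (\int[P]_w (\1_B (xi w))%:E = P (xi @^-1` B))%E.
Proof.
move=> mxi mB.
have mxB : measurable (xi @^-1` B).
  by rewrite -[X in measurable X]setTI; exact: mxi.
transitivity (\int[P]_w (\1_(xi @^-1` B) w)%:E)%E; first by [].
by rewrite integral_indic ?setIT.
Qed.

(** Simple functions follow by linearity, the rest by monotone convergence on both sides. [G] stands
    for the product of the remaining factors; finiteness of [c] lets it commute with the limit. *)
Lemma integral_indep_step d (T : measurableType d) (R : realType)
    (P : probability T R) (G xi : T -> R) (c : \bar R) :
  measurable_fun setT G -> (forall w, 0 <= G w) ->
  measurable_fun setT xi -> (c \is a fin_num) ->
  (forall B : set R, measurable B ->
     (\int[P]_w (G w * \1_B (xi w))%:E)%E = (c * P (xi @^-1` B))%E) ->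
  forall f : R -> R, measurable_fun setT f -> (forall r, 0 <= f r) ->
  (\int[P]_w (G w * f (xi w))%:E)%E = (c * \int[P]_w (f (xi w))%:E)%E.
Proof.
move=> mG G0 mxi cfin H f mf f0.
have mEf : measurable_fun [set: R] (EFin \o f) by exact/measurable_EFinP.
pose f_ := nnsfun_approx measurableT mEf.
have mf_ n : measurable_fun setT (fun w => f_ n (xi w)).
  by apply: measurableT_comp.
have cvgf x : (EFin \o (fun n => f_ n x)) @ \oo --> (f x)%:E.
  by apply: cvg_nnsfun_approx => // y _; rewrite lee_fin.
have ndf x : {homo (fun n => f_ n x) : n m / (n <= m)%N >-> n <= m}.
  by move=> n m nm; exact/lefP/nd_nnsfun_approx.
have f_0 n x : 0 <= f_ n x by [].
have E1 : (\int[P]_w (G w * f (xi w))%:E)%E =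
    limn (fun n => \int[P]_w (G w * f_ n (xi w))%:E)%E.
  rewrite -monotone_convergence//.
  - apply: eq_integral => w _; apply/esym/cvg_lim => //.
    rewrite EFinM; under eq_fun do rewrite EFinM.
    by apply: cvgeZl => //; exact: cvgf.
  - by move=> n; apply/measurable_EFinP; apply: measurable_funM.
  - by move=> n w _; rewrite lee_fin mulr_ge0.
  - by move=> w _ n m nm; rewrite lee_fin ler_wpM2l//; exact: ndf.
have E2 : (\int[P]_w (f (xi w))%:E = limn (fun n => \int[P]_w (f_ n (xi w))%:E))%E.
  rewrite -monotone_convergence//.
  - by apply: eq_integral => w _; apply/esym/cvg_lim => //; exact: cvgf.
  - by move=> n; apply/measurable_EFinP.
  - by move=> n w _; rewrite lee_fin.
  - by move=> w _ n m nm; rewrite lee_fin; exact: ndf.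
have cv2 : cvgn (fun n => \int[P]_w (f_ n (xi w))%:E)%E.
  apply: ereal_nondecreasing_is_cvgn => n m nm; apply: ge0_le_integral => //.
  - by move=> w _; rewrite lee_fin.
  - by apply/measurable_EFinP.
  - by apply/measurable_EFinP.
  - by move=> w _; rewrite lee_fin; exact: ndf.
rewrite E1 E2 -limeMl//.
congr (limn _); apply/funext => n.
have m1 k : measurable_fun setT (fun w => \1_(f_ n @^-1` [set k]) (xi w) : R).
  by apply: measurableT_comp => //; exact: measurable_indic.
have k0 k w : 0 <= k * \1_(f_ n @^-1` [set k]) (xi w).
  by rewrite -lee_fin; exact: nnfun_muleindic_ge0.
have fE w : f_ n (xi w) =
    \sum_(k \in range (f_ n)) k * \1_(f_ n @^-1` [set k]) (xi w).
  exact: fimfunE.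
transitivity (\sum_(k \in range (f_ n)) (c *
   \int[P]_w (k * \1_(f_ n @^-1` [set k]) (xi w))%:E)%E)%E; last first.
  rewrite -ge0_mule_fsumr.
    congr (c * _)%E; rewrite -ge0_integral_fsum//.
    - by apply: eq_integral => w _; rewrite fE fsumEFin.
    - by move=> k; apply/measurable_EFinP; apply: measurable_funM.
    by move=> k w _; rewrite lee_fin.
  by move=> k; apply: integral_ge0 => w _; rewrite lee_fin.
transitivity (\sum_(k \in range (f_ n))
    \int[P]_w (k * (G w * \1_(f_ n @^-1` [set k]) (xi w)))%:E)%E.
  rewrite -ge0_integral_fsum//.
  - apply: eq_integral => w _.
    rewrite fsumEFin//; congr (_%:E); rewrite fE.
    rewrite !fsbig_finite//= mulr_sumr; apply: eq_bigr => k _; ring.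
  - move=> k; apply/measurable_EFinP; apply: measurable_funM => //.
    exact: measurable_funM.
  - by move=> k w _; rewrite lee_fin mulrCA mulr_ge0.
apply: eq_fsbigr => k; rewrite inE => -[r _ <-].
under eq_integral do rewrite EFinM.
rewrite ge0_integralZl_EFin//; first last.
- by apply/measurable_EFinP; exact: measurable_funM.
- by move=> w _; rewrite lee_fin mulr_ge0//.
rewrite H//; under [in RHS]eq_integral do rewrite EFinM.
rewrite ge0_integralZl_EFin//; first last.
- exact/measurable_EFinP.
by rewrite integral_indic_preimage// muleCA.
Qed.

Lemma measurable_prod_cond d (T : measurableType d) (R : realType)
    (I : finType) (D : pred I) (h : I -> T -> R) :
  (forall i, measurable_fun setT (h i)) ->
  measurable_fun setT (fun w => \prod_(i | D i) h i w).
Proof.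
move=> mh; under eq_fun do rewrite -big_filter.
by apply: measurable_prod => i _; exact: mh.
Qed.

(** Independence is given on sets only. The list [s] holds the indices whose factor may be an
    arbitrary function, all others being indicators; the induction frees one index at a time. *)
Lemma mutually_independent_expectation d (T : measurableType d) (R : realType)
    (P : probability T R) (I : finType) (D : {pred I}) (F : I -> T -> R) :
  mutually_independent P D F -> (forall i, measurable_fun setT (F i)) ->
  forall (s : seq I), uniq s -> forall f : I -> R -> R,
  (forall i, measurable_fun setT (f i)) -> (forall i r, 0 <= f i r) ->
  (forall i, (\int[P]_w (f i (F i w))%:E)%E \is a fin_num) ->
  (forall i, i \notin s -> exists2 B : set R, measurable B & f i = \1_B) ->
  (\int[P]_w (\prod_(i in D) f i (F i w))%:E
    = \prod_(i in D) \int[P]_w (f i (F i w))%:E)%E.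
Proof.
move=> ind mF.
have mFB i B : measurable B -> measurable (F i @^-1` B).
  by move=> mB; rewrite -[X in measurable X]setTI; exact: mF.
have int1 i B : measurable B ->
    (\int[P]_w (\1_B (F i w))%:E)%E = P (F i @^-1` B).
  by move=> mB; exact: integral_indic_preimage.
elim=> [_|i0 s IH /= /andP[i0s us]] f mf f0 ffin fB.
  have {fB} /choice[B HB] i : exists B : set R, measurable B /\ f i = \1_B.
    by have [//|B] := fB i; exists B.
  have mB i : measurable (B i) by have [] := HB i.
  have fE i : f i = \1_(B i) by have [] := HB i.
  have -> : (\prod_(i in D) \int[P]_w (f i (F i w))%:E =
      \prod_(i in D) P (F i @^-1` B i))%E.
    by apply: eq_bigr => i _; rewrite fE int1.
  rewrite -ind//; set E := [set w | _].
  have prodE w : \prod_(i in D) f i (F i w) = \1_E w.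
    rewrite indicE; have [/[!inE] Ew|Ew] := boolP (w \in E).
      by rewrite big1// => i iD; rewrite fE indicE mem_set//; exact: Ew.
    have [i /andP[iD nB]] : exists i, (i \in D) && (F i w \notin B i).
      apply: contrapT => nex; move: Ew; rewrite notin_setE; apply => i iD.
      by apply: contrapT => nB; apply: nex; exists i; rewrite iD notin_setE.
    by rewrite (bigD1 i)//= fE indicE (negbTE nB) mul0r.
  have mE : measurable E.
    rewrite (_ : E = (fun w => \prod_(i in D) f i (F i w)) @^-1` [set 1]).
      rewrite -[X in measurable X]setTI.
      have : measurable_fun setT (fun w => \prod_(i in D) f i (F i w)).
        by apply: measurable_prod_cond => i; apply: measurableT_comp.
      by apply.
    apply/seteqP; split => w /=; rewrite prodE indicE.
      by move=> Ew; rewrite mem_set.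
    by have [/[!inE]//|_ /eqP] := boolP (w \in E); rewrite eq_sym oner_eq0.
  under eq_integral do rewrite prodE.
  by rewrite integral_indic ?setIT.
have [i0D|i0D] := boolP (i0 \in D); last first.
  (* An index outside [D] does not enter the product, so its function may be replaced by an
     indicator. *)
  pose f' i := if i == i0 then \1_setT else f i.
  have ff' i : i \in D -> f i = f' i.
    by rewrite /f'; have [->|//] := eqVneq i i0; rewrite (negbTE i0D).
  have ffw w : \prod_(i in D) f i (F i w) = \prod_(i in D) f' i (F i w).
    by apply: eq_bigr => i iD; rewrite ff'.
  under eq_integral do rewrite ffw.
  rewrite [RHS](eq_bigr (fun i => \int[P]_w (f' i (F i w))%:E)%E); last first.
    by move=> i iD; rewrite ff'.
  apply: (IH us f') => i; rewrite /f'; case: ifPn => [_|ii0]//.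
  - by rewrite int1// preimage_setT probability_setT.
  - by exists setT.
  - by move=> iis; apply: fB; rewrite inE negb_or iis andbT.
pose G w := \prod_(i in D | i != i0) f i (F i w).
pose c := (\prod_(i in D | i != i0) \int[P]_w (f i (F i w))%:E)%E.
have cfin : c \is a fin_num by apply: prode_fin_num.
rewrite (bigD1 i0)//= -/c.
under eq_integral do rewrite (bigD1 i0)//= mulrC -/(G _).
rewrite muleC; apply: integral_indep_step => //.
- by apply: measurable_prod_cond => i; apply: measurableT_comp.
- by move=> w; apply: prodr_ge0.
move=> B mB.
(* With an indicator at [i0] the induction hypothesis applies and gives what [integral_indep_step]
   asks for. *)
pose f' i := if i == i0 then \1_B else f i.
have f'i0 : f' i0 = \1_B by rewrite /f' eqxx.
have f'ne i : i != i0 -> f' i = f i by rewrite /f' => /negbTE ->.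
have := IH us f' _ _ _.
rewrite (bigD1 i0)//= f'i0 int1// muleC.
under eq_integral do rewrite (bigD1 i0)//= mulrC f'i0.
under eq_bigr => i /andP[_ ii0] do rewrite f'ne//.
under eq_integral do under eq_bigr => i /andP[_ ii0] do rewrite f'ne//.
apply => i; rewrite /f'; case: ifPn => [_|ii0]//.
- by rewrite int1// fin_num_measure//; exact: mFB.
- by exists B.
- by move=> iis; apply: fB; rewrite inE negb_or iis andbT.
Qed.

(** * Subgaussian moment generating functions *)

Lemma psi2norm_moment d (T : measurableType d) (R : realType)
    (P : probability T R) (xi : T -> R) (k : nat) :
  (psi2norm P xi <= 1)%E -> (0 < k)%N ->
  (\int[P]_w (xi w ^+ k.*2)%:E <= ((k.*2%:R) ^+ k)%:E)%E.
Proof.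
move=> psi k0; set q : R := k.*2%:R.
have q1 : 1 <= q by rewrite ler1n double_gt0.
have q0 : 0 < q by exact: lt_le_trans q1.
have : ((q `^ (- 2^-1))%:E *
    poweR ('E_P[fun w => (`|xi w| `^ q)%R]) q^-1 <= 1)%E.
  by apply: le_trans psi; apply: ereal_sup_ubound; exists q.
have -> : ('E_P[fun w => (`|xi w| `^ q)%R] = \int[P]_w (xi w ^+ k.*2)%:E)%E.
  rewrite unlock; apply: eq_integral => w _; congr (_%:E).
  by rewrite /q powR_mulrn// -normrX -mul2n exprM ger0_norm// exprn_ge0// sqr_ge0.
have : (0 <= \int[P]_w (xi w ^+ k.*2)%:E)%E.
  by apply: integral_ge0 => w _; rewrite lee_fin -mul2n exprM exprn_ge0// sqr_ge0.
case: (\int[P]_w _)%E => [e||//].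
- rewrite lee_fin poweR_EFin -EFinM !lee_fin => e0.
  rewrite powRN ler_pdivrMl ?powR_gt0// mulr1 => H.
  have := @ge0_ler_powR _ q (ltW q0) _ _ _ _ H.
  rewrite !nnegrE !powR_ge0 -!powRrM mulVf ?gt_eqF// powRr1// => /(_ isT isT) /le_trans; apply.
  have -> : 2^-1 * q = k%:R by rewrite /q -mul2n natrM mulrA mulVf ?mul1r.
  by rewrite powR_mulrn// ltW.
(* An infinite moment would make the norm infinite. *)
- by rewrite poweRyr ?invr_eq0 ?gt_eqF// gt0_muley ?lte_fin ?powR_gt0.
Qed.

(* With moments at most [(2 k) ^ k] and [k ^ k / k! <= e ^ k], the exponential
   series at this rate is dominated by the geometric series of ratio 1/2. *)
Definition psi2_rate (R : realType) : R := (4 * expR 1)^-1.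

Lemma psi2_rate_gt0 (R : realType) : 0 < psi2_rate R.
Proof. by rewrite invr_gt0 mulr_gt0// expR_gt0. Qed.

Lemma psi2norm_expR_sqr d (T : measurableType d) (R : realType)
    (P : probability T R) (xi : T -> R) :
  measurable_fun setT xi -> (psi2norm P xi <= 1)%E ->
  (\int[P]_w (expR (psi2_rate R * xi w ^+ 2))%:E <= 2%:E)%E.
Proof.
move=> mxi psi; set c := psi2_rate R.
have c0 : 0 < c := psi2_rate_gt0 R.
pose u k w := exp_coeff (c * xi w ^+ 2) k.
have u0 k w : 0 <= u k w.
  by apply: exp_coeff_ge0; rewrite mulr_ge0 ?sqr_ge0// ltW.
have mu k : measurable_fun setT (u k).
  apply: measurable_funM => //; apply: measurable_funX.
  by apply: measurable_funM => //; exact: measurable_funX.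
have intu k : (\int[P]_w (u k w)%:E <= (2^-1 ^+ k)%:E)%E.
  have [->|k0] := posnP k.
    rewrite (eq_integral (cst 1%E)); last first.
      by move=> w _; rewrite /u /exp_coeff /= expr0 fact0 divr1.
    by rewrite integral_cst// mul1e expr0; exact: probability_le1.
  rewrite (eq_integral (fun w => (c ^+ k / k`!%:R)%:E * (xi w ^+ k.*2)%:E)%E); last first.
    move=> w _; rewrite -EFinM; congr (_%:E).
    by rewrite /u /exp_coeff/= exprMn -exprM mul2n mulrAC.
  rewrite ge0_integralZl_EFin//; last 3 first.
  - by move=> w _; rewrite lee_fin -mul2n exprM exprn_ge0// sqr_ge0.
  - by apply/measurable_EFinP; exact: measurable_funX.
  - by rewrite divr_ge0// exprn_ge0// ltW.
  apply: (@le_trans _ _ ((c ^+ k / k`!%:R)%:E * ((k.*2%:R) ^+ k)%:E)%E).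
    by rewrite lee_pmul2l ?lte_fin ?divr_gt0 ?exprn_gt0 ?ltr0n ?fact_gt0//; exact: psi2norm_moment.
  rewrite -EFinM lee_fin.
  have kk : k%:R ^+ k / k`!%:R <= expR 1 ^+ k :> R.
    rewrite -expRM_natl mulr1.
    case: k k0 => // k _; have := @expR_ge1Dxn R k.+1%:R k (ler0n _ _).
    by apply: le_trans; rewrite lerDr.
  have -> : c ^+ k / k`!%:R * k.*2%:R ^+ k = (c * 2) ^+ k * (k%:R ^+ k / k`!%:R).
    by rewrite -mul2n natrM !exprMn; ring.
  have c2 : 0 <= c * 2 by rewrite mulr_ge0// ltW.
  apply: (@le_trans _ _ ((c * 2) ^+ k * expR 1 ^+ k)).
    by rewrite ler_wpM2l// exprn_ge0.
  rewrite -exprMn (_ : c * 2 * expR 1 = 2^-1)//.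
  rewrite /c /psi2_rate; field; rewrite gt_eqF ?expR_gt0//.
have E : (\int[P]_w (expR (c * xi w ^+ 2))%:E =
    limn (fun n => \int[P]_w (series (u^~ w) n)%:E))%E.
  rewrite -monotone_convergence//.
  - apply: eq_integral => w _; rewrite -EFin_lim//.
    exact: is_cvg_series_exp_coeff.
  - move=> n; apply/measurable_EFinP; rewrite /series/=.
    by apply: measurable_sum.
  - by move=> n w _; rewrite lee_fin; apply: sumr_ge0.
  - move=> w _ n m nm; rewrite lee_fin; apply: nondecreasing_series => //.
rewrite E; apply: lime_le.
  apply: ereal_nondecreasing_is_cvgn => n m nm; apply: ge0_le_integral => //.
  - by move=> w _; rewrite lee_fin; apply: sumr_ge0.
  - by apply/measurable_EFinP; exact: measurable_sum.
  - by apply/measurable_EFinP; exact: measurable_sum.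
  - by move=> w _; rewrite lee_fin; apply: nondecreasing_series.
apply: nearW => n.
have -> : (\int[P]_w (series (u^~ w) n)%:E = \sum_(0 <= k < n) \int[P]_w (u k w)%:E)%E.
  rewrite -ge0_integral_sum//.
  - by apply: eq_integral => w _; rewrite /series/= sumEFin.
  - by move=> k; apply/measurable_EFinP.
  - by move=> k w _; rewrite lee_fin.
apply: (@le_trans _ _ (\sum_(0 <= k < n) (2^-1 ^+ k)%:E)%E).
  by apply: lee_sum.
rewrite sumEFin lee_fin big_mkord.
have h : 2^-1 ^+ n - 1 = (2^-1 - 1) * \sum_(k < n) 2^-1 ^+ k :> R.
  exact: subrX1.
have h0 : 0 <= 2^-1 ^+ n :> R by rewrite exprn_ge0.
lra.
Qed.

(** Separates a linear part, killed by centering, from an even part, controlled by the exponential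
    moment of the square. For x <= 1/2 it passes through 1 + x + 2 x^2, using e^x (1 - x) <= 1 and
    (1 + x + 2 x^2)(1 - x) = 1 + x^2 (1 - 2 x). *)
Lemma expR_le_addr_expR_sqr (R : realType) (x : R) :
  expR x <= x + expR (2 * x ^+ 2).
Proof.
have [x2|x2] := leP x 2^-1; last first.
  have : expR x <= expR (2 * x ^+ 2) by rewrite ler_expR; nra.
  lra.
have h1 : 1 + 2 * x ^+ 2 <= expR (2 * x ^+ 2) := expR_ge1Dx _.
have h2 : 1 + - x <= expR (- x) := expR_ge1Dx _.
have h3 : expR x * expR (- x) = 1 := expRxMexpNx_1 x.
have h4 := expR_gt0 x.
have h5 : expR x * (1 - x) <= 1 by nra.
have h6 : 1 <= (1 + x + 2 * x ^+ 2) * (1 - x) by nra.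
suff : expR x <= 1 + x + 2 * x ^+ 2 by lra.
by rewrite -(@ler_pM2r _ (1 - x)); lra.
Qed.

(* Average the tangent-line bounds of [expR] at [a * s], evaluated at [s] and at [0]. *)
Lemma expR_scale_le (R : realType) (a s : R) : 0 <= a <= 1 ->
  expR (a * s) <= 1 - a + a * expR s.
Proof.
move=> /andP[a0 a1].
have t1 : 1 + (1 - a) * s <= expR ((1 - a) * s) := expR_ge1Dx _.
have t2 : 1 + - (a * s) <= expR (- (a * s)) := expR_ge1Dx _.
have e0 := expR_gt0 (a * s).
have e1 : expR s = expR (a * s) * expR ((1 - a) * s).
  by rewrite -expRD; congr expR; ring.
have e2 := expRxMexpNx_1 (a * s).
have h1 : expR (a * s) * (1 + (1 - a) * s) <= expR s.
  by rewrite e1 ler_wpM2l// ltW.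
have h2 : expR (a * s) * (1 + - (a * s)) <= 1.
  by rewrite -[leRHS]e2 ler_wpM2l// ltW.
have : a * (expR (a * s) * (1 + (1 - a) * s)) <= a * expR s by rewrite ler_wpM2l.
have : (1 - a) * (expR (a * s) * (1 + - (a * s))) <= (1 - a) * 1.
  by rewrite ler_wpM2l// subr_ge0.
lra.
Qed.

Lemma mgf_le d (T : measurableType d) (R : realType)
    (P : probability T R) (xi : T -> R) (c : R) :
  0 < c -> measurable_fun setT xi -> ('E_P[xi] = 0)%E ->
  (\int[P]_w (expR (c * xi w ^+ 2))%:E <= 2%:E)%E ->
  forall a : R, (\int[P]_w (expR (a * xi w))%:E <= (expR (3 / c * a ^+ 2))%:E)%E.
Proof.
move=> c0 mxi Exi0 Esq a.
have mE : measurable_fun setT (fun w => expR (c * xi w ^+ 2)).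
  apply: measurableT_comp => //.
  by apply: measurable_funM => //; exact: measurable_funX.
have mEa : measurable_fun setT (fun w => expR (a * xi w)).
  by apply: measurableT_comp => //; exact: measurable_funM.
have iE : P.-integrable setT (EFin \o (fun w => expR (c * xi w ^+ 2))).
  apply/integrableP; split; first by apply/measurable_EFinP.
  rewrite (eq_integral (fun w => (expR (c * xi w ^+ 2))%:E)); last first.
    by move=> w _; rewrite /= ger0_norm// expR_ge0.
  by apply: le_lt_trans Esq _; rewrite ltry.
have i1 (r : R) : P.-integrable setT (EFin \o (fun _ => r)).
  exact: finite_measure_integrable_cst.
have [a2|a2] := leP (2 * a ^+ 2) c; last first.
  apply: (@le_trans _ _ (\int[P]_w ((expR (a ^+ 2 / (4 * c)))%:E *
      (expR (c * xi w ^+ 2))%:E))%E).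
    apply: ge0_le_integral => //.
    - by apply/measurable_EFinP.
    - by apply/measurable_EFinP; exact: measurable_funM.
    - move=> w _; rewrite -EFinM lee_fin -expRD ler_expR.
      have : 0 <= (a / (2 * c) - xi w) ^+ 2 * c by rewrite mulr_ge0 ?sqr_ge0// ltW.
      have -> : (a / (2 * c) - xi w) ^+ 2 * c =
         a ^+ 2 / (4 * c) + c * xi w ^+ 2 - a * xi w.
        by field; rewrite gt_eqF.
      lra.
  rewrite ge0_integralZl_EFin//; last by apply/measurable_EFinP.
  apply: (@le_trans _ _ ((expR (a ^+ 2 / (4 * c)))%:E * 2%:E)%E).
    by rewrite lee_pmul2l// lte_fin expR_gt0.
  rewrite -EFinM lee_fin.
  apply: (@le_trans _ _ (expR (a ^+ 2 / (4 * c)) * expR 1)).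
    rewrite ler_wpM2l ?expR_ge0//.
    by have := @expR_ge1Dx R 1; lra.
  rewrite -expRD ler_expR.
  have ac : 2^-1 < a ^+ 2 / c by rewrite ltr_pdivlMr//; lra.
  have -> : a ^+ 2 / (4 * c) = 4^-1 * (a ^+ 2 / c) by field; rewrite gt_eqF.
  have -> : 3 / c * a ^+ 2 = 3 * (a ^+ 2 / c) by ring.
  lra.
(* Chosen so that 2 (a xi)^2 = t (c xi^2). Since t <= 1, [expR_scale_le] applies, and integration
   leaves at most 1 + t <= e^t. *)
pose t := 2 * a ^+ 2 / c.
have t0 : 0 <= t.
  by apply: divr_ge0 (ltW c0); apply: mulr_ge0 => //; exact: sqr_ge0.
have t1 : t <= 1 by rewrite /t ler_pdivrMr// mul1r.
have ixi : P.-integrable setT (EFin \o xi).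
  apply: (@le_integrable _ _ _ P setT measurableT _
    (EFin \o (fun w => 1 + c^-1 * expR (c * xi w ^+ 2)))).
  - by apply/measurable_EFinP.
  - move=> w _; rewrite /= lee_fin.
    have h : c * xi w ^+ 2 <= expR (c * xi w ^+ 2).
      by apply: le_trans (expR_ge1Dx _); rewrite lerDr.
    have h2 : xi w ^+ 2 <= c^-1 * expR (c * xi w ^+ 2).
      by rewrite ler_pdivlMl.
    rewrite [leRHS]ger0_norm; last first.
      by rewrite addr_ge0// mulr_ge0 ?expR_ge0// invr_ge0 ltW.
    have : 0 <= (`|xi w| - 1) ^+ 2 by exact: sqr_ge0.
    have : `|xi w| ^+ 2 = xi w ^+ 2 by rewrite real_normK// num_real.
    have : 0 <= `|xi w| by [].
    nra.
  - have -> : EFin \o (fun w => 1 + c^-1 * expR (c * xi w ^+ 2)) =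
      (EFin \o (fun=> 1)) \+ (fun w => c^-1%:E * (EFin \o (fun w => expR (c * xi w ^+ 2))) w)%E.
      by apply/funext => w /=; rewrite EFinD EFinM.
    by apply: integrableD => //; exact: integrableZl.
have iaxi : P.-integrable setT (fun w => a%:E * (EFin \o xi) w)%E.
  exact: integrableZl.
have itE : P.-integrable setT (fun w => t%:E * (EFin \o (fun w => expR (c * xi w ^+ 2))) w)%E.
  exact: integrableZl.
have dom w : expR (a * xi w) <=
    a * xi w + ((1 - t) + t * expR (c * xi w ^+ 2)).
  have := expR_le_addr_expR_sqr _ (a * xi w).
  have := expR_scale_le _ t (c * xi w ^+ 2).
  have -> : t * (c * xi w ^+ 2) = 2 * (a * xi w) ^+ 2.
    by rewrite /t; field; rewrite gt_eqF.
  rewrite t0 t1 => /(_ isT); lra.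
pose g w := a * xi w + ((1 - t) + t * expR (c * xi w ^+ 2)).
have gE : EFin \o g = ((fun w => a%:E * (EFin \o xi) w) \+
   ((EFin \o (fun=> (1 - t)%R)) \+
    (fun w => t%:E * (EFin \o (fun w => expR (c * xi w ^+ 2)%R)) w)))%E.
  by apply/funext => w /=; rewrite /g !EFinD !EFinM.
have ig : P.-integrable setT (EFin \o g).
  by rewrite gE; apply: integrableD => //; apply: integrableD.
apply: (@le_trans _ _ (\int[P]_w (EFin \o g) w)%E).
  apply: le_integral => //.
  - apply: (@le_integrable _ _ _ P setT measurableT _ (EFin \o g)) => //.
    + by apply/measurable_EFinP.
    + move=> w _ /=; rewrite lee_fin ger0_norm ?expR_ge0//.
      exact: le_trans (dom w) (ler_norm _).
  - by move=> w _; rewrite lee_fin; exact: dom.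
rewrite gE.
rewrite integralD//; last by apply: integrableD.
rewrite integralD// !integralZl//.
move: Exi0; rewrite unlock => ->.
rewrite mule0 add0e integral_cst// .
apply: (@le_trans _ _ ((1 - t)%:E + t%:E * 2%:E)%E).
  apply: leeD; last by rewrite lee_wpmul2l.
  by rewrite -[leRHS]mule1 lee_wpmul2l ?lee_fin ?subr_ge0//; exact: probability_le1.
rewrite -EFinM -EFinD lee_fin.
apply: (@le_trans _ _ (expR t)); first by have := expR_ge1Dx t; lra.
rewrite ler_expR /t.
have -> : 3 / c * a ^+ 2 = 3 * (a ^+ 2 / c) by ring.
have -> : 2 * a ^+ 2 / c = 2 * (a ^+ 2 / c) by ring.
have : 0 <= a ^+ 2 / c by rewrite divr_ge0 ?sqr_ge0// ltW.
lra.
Qed.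

Lemma mutually_independent_mgf_le d (T : measurableType d) (R : realType)
    (P : probability T R) (I : finType) (D : {pred I}) (F : I -> T -> R) (K : R) :
  mutually_independent P D F -> (forall i, measurable_fun setT (F i)) ->
  (forall i, i \in D -> forall a : R,
    (\int[P]_w (expR (a * F i w))%:E <= (expR (K * a ^+ 2))%:E)%E) ->
  forall a : I -> R,
  (\int[P]_w (expR (\sum_(i in D) a i * F i w))%:E <=
    (expR (K * \sum_(i in D) a i ^+ 2))%:E)%E.
Proof.
move=> ind mF HK a.
(* The value 1 off [D] keeps every integral finite, as the product formula requires, although the
   bound is known on [D] only. *)
pose f i r := if i \in D then expR (a i * r) else 1.
under eq_integral do rewrite expR_sum.
have mf i : measurable_fun setT (f i).
  rewrite /f; case: (i \in D) => //.
  by apply: measurableT_comp => //; exact: measurable_funM.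
have f0 i r : 0 <= f i r by rewrite /f; case: ifP => // _; exact: expR_ge0.
have If0 i : (0 <= \int[P]_w (f i (F i w))%:E)%E.
  by apply: integral_ge0 => w _; rewrite lee_fin.
have ffin i : (\int[P]_w (f i (F i w))%:E)%E \is a fin_num.
  rewrite ge0_fin_numE//; rewrite /f; have := HK i; case: (i \in D) => [h|_].
    by apply: le_lt_trans (h isT (a i)) _; rewrite ltry.
  have := integral_cst P measurableT 1%E; rewrite /cst => ->.
  by rewrite mul1e (le_lt_trans (probability_le1 _ _))// ltry.
have ffw w : \prod_(i in D) expR (a i * F i w) = \prod_(i in D) f i (F i w).
  by apply: eq_bigr => i iD; rewrite /f iD.
under eq_integral do rewrite ffw.
rewrite (mutually_independent_expectation _ _ _ _ _ _ _ ind mF (index_enum I))//; last first.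
- by move=> i; rewrite mem_index_enum.
- exact: index_enum_uniq.
rewrite mulr_sumr expR_sum -prodEFin.
suff [] : (0 <= \prod_(i in D) \int[P]_w (f i (F i w))%:E /\
   \prod_(i in D) \int[P]_w (f i (F i w))%:E <= \prod_(i in D) (expR (K * a i ^+ 2))%:E)%E by [].
apply: (big_ind2 (fun x y : \bar R => 0 <= x /\ x <= y)%E) => //.
- by move=> x1 x2 y1 y2 [? ?] [? ?]; split; [exact: mule_ge0|exact: lee_pmul].
- move=> i iD; split => //; apply: le_trans (HK i iD (a i)).
  by rewrite /f iD.
Qed.

(** * The random lattice net *)

(** A size and a sign, so that the lattice vectors form a finite type. Zero has two codes, and the
    weights below count both. *)
Definition lattice_value (R : realType) M (q : 'I_M.+1 * bool) : R :=
  (-1) ^+ (~~ q.2) * q.1%:R.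

(* A sub-probability weight on lattice vectors supported in [S]. *)
Definition lattice_weight (R : realType) n M (S : {set 'I_n})
    (u : {ffun 'I_n -> 'I_M.+1 * bool}) : R :=
  \prod_i (if i \in S then 2^-1 ^+ (u i).1.+2 else (u i == (ord0, true))%:R).

Lemma lattice_value_sqr (R : realType) M (q : 'I_M.+1 * bool) :
  lattice_value R M q ^+ 2 = q.1%:R ^+ 2.
Proof. by rewrite /lattice_value exprMn sqrr_sign mul1r. Qed.

Lemma lattice_weight_ge0 (R : realType) n M (S : {set 'I_n}) u :
  0 <= lattice_weight R n M S u.
Proof.
apply: prodr_ge0 => i _; case: ifP => _; last exact: ler0n.
by rewrite exprn_ge0.
Qed.

Lemma sum_lattice_weight_le1 (R : realType) n M (S : {set 'I_n}) :
  \sum_u lattice_weight R n M S u <= 1.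
Proof.
rewrite /lattice_weight -(bigA_distr_bigA (fun i (q : 'I_M.+1 * bool) =>
  if i \in S then 2^-1 ^+ q.1.+2 else (q == (ord0, true))%:R : R)).
apply: prodr_ile1 => i _; case: (i \in S); apply/andP; split.
- by apply: sumr_ge0 => q _; rewrite exprn_ge0.
- rewrite -(pair_big xpredT xpredT (fun (k : 'I_M.+1) (b : bool) => 2^-1 ^+ k.+2 : R))/=.
  (* The two signs turn 2^-(k+2) into 2^-(k+1), whose sum stays below 1. *)
  rewrite (eq_bigr (fun k : 'I_M.+1 => 2^-1 * 2^-1 ^+ k)); last first.
    move=> k _; rewrite big_bool /=  !exprS; lra.
  rewrite -mulr_sumr.
  have h := subrX1 (2^-1 : R) M.+1.
  have h0 : 0 <= 2^-1 ^+ M.+1 :> R by rewrite exprn_ge0.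
  lra.
- by apply: sumr_ge0 => q _; rewrite ler0n.
- by rewrite (bigD1 (ord0, true))//= big1 ?addr0// => q /negbTE ->.
Qed.

(** By 2 <= e and k <= k^2, a coordinate of size k costs at most k^2 + 2 in the exponent. *)
Lemma lattice_weight_ge (R : realType) n M (S : {set 'I_n})
    (u : {ffun 'I_n -> 'I_M.+1 * bool}) :
  (forall i, i \notin S -> u i = (ord0, true)) ->
  expR (- (\sum_i lattice_value R M (u i) ^+ 2 + 2 * #|S|%:R)) <=
  lattice_weight R n M S u.
Proof.
move=> uS.
have -> : 2 * #|S|%:R = \sum_i (if i \in S then 2 else 0) :> R.
  by rewrite -big_mkcond/= sumr_const mulr_natr.
rewrite -big_split/= -sumrN expR_sum; apply: ler_prod => i _; rewrite expR_ge0/=.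
rewrite lattice_value_sqr; case: ifPn => iS; last first.
  by rewrite uS// eqxx/= expr0n addr0 oppr0 expR0.
rewrite expRN exprVn lef_pV2 ?posrE ?expR_gt0 ?exprn_gt0//.
apply: (@le_trans _ _ (expR 1 ^+ (u i).1.+2)).
  apply: lerXn2r; rewrite ?nnegrE ?expR_ge0//.
  by have := expR_ge1Dx (1 : R); lra.
rewrite -expRM_natl mulr1 ler_expR -addn2 natrD.
have : ((u i).1 <= (u i).1 ^ 2)%N.
  by case: (nat_of_ord _) => // k; rewrite -{1}[k.+1]expn1 leq_pexp2l.
by rewrite -(ler_nat R) natrX => h; lra.
Qed.

(** Rounding goes away from zero for r >= 0 and towards zero for r < 0; in both cases the modulus
    grows by at most 1, and the strict bound by [M] leaves room for it. *)
Lemma lattice_round_up (R : realType) M (r : R) : `|r| < M%:R ->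
  exists q : 'I_M.+1 * bool, r <= lattice_value R M q /\
    lattice_value R M q ^+ 2 <= (`|r| + 1) ^+ 2.
Proof.
move=> rM.
have r0 : 0 <= `|r| by [].
pose k := Num.truncn `|r|.
have /andP[k1 k2] : k%:R <= `|r| < k.+1%:R := truncn_itv r0.
have kM : (k < M)%N by rewrite -(ltr_nat R); exact: le_lt_trans rM.
have kM1 : (k < M.+1)%N by exact: ltnW.
have k1M : (k.+1 < M.+1)%N by [].
have [r_ge0|r_lt0] := leP 0 r.
- exists (Ordinal k1M, true); rewrite lattice_value_sqr /lattice_value /= expr0 mul1r.
  rewrite ger0_norm// in k1 k2 *; split; first exact: ltW.
  by rewrite lerXn2r ?nnegrE ?addr_ge0// -natr1; lra.
- exists (Ordinal kM1, false); rewrite lattice_value_sqr /lattice_value /= expr1.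
  rewrite ltr0_norm// in k1 k2 r0 *; split; first lra.
  by rewrite lerXn2r ?nnegrE ?addr_ge0//; lra.
Qed.

Lemma lattice_round (R : realType) M (r c : R) : `|r| < M%:R ->
  exists q : 'I_M.+1 * bool, c * r <= c * lattice_value R M q /\
    lattice_value R M q ^+ 2 <= (`|r| + 1) ^+ 2.
Proof.
move=> rM; have [c0|c0] := leP 0 c.
  have [q [q1 q2]] := lattice_round_up R M r rM.
  by exists q; split => //; rewrite ler_wpM2l.
have [|[k b] [q1 q2]] := lattice_round_up R M (- r); first by rewrite normrN.
have E : lattice_value R M (k, ~~ b) = - lattice_value R M (k, b).
  by rewrite /lattice_value/= -mulNr -signrN.
exists (k, ~~ b); rewrite E sqrrN -(normrN r); split => //.
by rewrite ler_wnM2l//; lra.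
Qed.

(** The sign of [c i] decides the direction of rounding at i. The norm bound comes from (|r| + 1)^2
    <= 2 r^2 + 2, summed over [S]. *)
Lemma lattice_round_fun (R : realType) n M (S : {set 'I_n}) (x c : 'I_n -> R) :
  (forall i, i \notin S -> x i = 0) -> (forall i, `|x i| < M%:R) ->
  \sum_i x i ^+ 2 <= #|S|%:R ->
  exists u : {ffun 'I_n -> 'I_M.+1 * bool},
  [/\ forall i, i \notin S -> u i = (ord0, true),
      \sum_i c i * x i <= \sum_i c i * lattice_value R M (u i) &
      \sum_i lattice_value R M (u i) ^+ 2 <= 4 * #|S|%:R].
Proof.
move=> xS xM xs.
have /choice[u Hu] i : exists q : 'I_M.+1 * bool,
    [/\ i \notin S -> q = (ord0, true),
        c i * x i <= c i * lattice_value R M q &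
        lattice_value R M q ^+ 2 <= 2 * x i ^+ 2 + (if i \in S then 2 else 0)].
  case: ifPn => iS; last first.
    exists (ord0, true); rewrite xS// /lattice_value /= !mulr0 expr0n/=; split => //.
    by rewrite mulr0 addr0.
  have [q [q1 q2]] := lattice_round R M (x i) (c i) (xM i).
  exists q; split => //; apply: le_trans q2 _.
  have : `|x i| ^+ 2 = x i ^+ 2 by rewrite real_normK// num_real.
  have : 0 <= (`|x i| - 1) ^+ 2 by exact: sqr_ge0.
  nra.
exists [ffun i => u i]; split.
- by move=> i iS; rewrite ffunE; have [->] := Hu i.
- by apply: ler_sum => i _; rewrite ffunE; have [] := Hu i.
apply: (@le_trans _ _ (\sum_i (2 * x i ^+ 2 + (if i \in S then 2 else 0)))).
  by apply: ler_sum => i _; rewrite ffunE; have [] := Hu i.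
rewrite big_split/= -mulr_sumr -big_mkcond/= sumr_const -mulr_natr.
lra.
Qed.

Definition bilin (R : realType) n (xi : 'I_n -> 'I_n -> R) (x y : 'I_n -> R) : R :=
  \sum_i \sum_j xi i j * x i * y j.

(** The subtracted term is the subgaussian bound, with constant [K], on the logarithm of the
    exponential moment; it normalises each term to expectation at most 1. *)
Definition lattice_term (R : realType) n M (K l : R) (xi : 'I_n -> 'I_n -> R)
    (u v : {ffun 'I_n -> 'I_M.+1 * bool}) : R :=
  expR (l * bilin R n xi (fun i => lattice_value R M (u i))
                         (fun j => lattice_value R M (v j))
   - K * l ^+ 2 * ((\sum_i lattice_value R M (u i) ^+ 2) *
                   (\sum_j lattice_value R M (v j) ^+ 2))).

Definition lattice_sum (R : realType) n M (K l : R) (S T : {set 'I_n})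
    (xi : 'I_n -> 'I_n -> R) : R :=
  \sum_u \sum_v lattice_weight R n M S u * lattice_weight R n M T v *
    lattice_term R n M K l xi u v.

Lemma lattice_sum_ge0 (R : realType) n M (K l : R) (S T : {set 'I_n}) xi :
  0 <= lattice_sum R n M K l S T xi.
Proof.
apply: sumr_ge0 => u _; apply: sumr_ge0 => v _.
by rewrite !mulr_ge0 ?lattice_weight_ge0 ?expR_ge0.
Qed.

(** A union bound with weights in place of counting: the summand at the rounded pair is at most the
    whole sum. Squared norms at most 4 |S| and 4 |T| give the 16; with the 2 |S| and 2 |T| of the
    weights they give the 6. *)
Lemma bilin_le_lattice (R : realType) n (K l N : R) (S T : {set 'I_n}) xi
    (x y : 'I_n -> R) :
  0 <= K -> 0 < l ->
  (forall i, i \notin S -> x i = 0) -> (forall i, i \notin T -> y i = 0) ->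
  \sum_i x i ^+ 2 <= #|S|%:R -> \sum_i y i ^+ 2 <= #|T|%:R ->
  lattice_sum R n n.+1 K l S T xi <= expR N ->
  l * bilin R n xi x y <=
    N + 16 * K * l ^+ 2 * (#|S|%:R * #|T|%:R) + 6 * (#|S|%:R + #|T|%:R).
Proof.
move=> K0 l0 xS yT xs yt ZN.
(* Coordinates are at most [sqrt n], so the lattice of range [n.+1] contains every rounding. *)
have bnd (U : {set 'I_n}) (z : 'I_n -> R) : \sum_i z i ^+ 2 <= #|U|%:R ->
    forall i, `|z i| < n.+1%:R.
  move=> zU i.
  have h : `|z i| ^+ 2 <= n%:R.
    rewrite real_normK ?num_real//; apply: le_trans (_ : #|U|%:R <= _).
      by apply: le_trans zU; rewrite (bigD1 i)//= lerDl sumr_ge0// => j _; exact: sqr_ge0.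
    by rewrite ler_nat -[leqRHS]card_ord max_card.
  have n0 : 0 <= n%:R :> R by [].
  rewrite ltNge; apply/negP => h2.
  have : n.+1%:R ^+ 2 <= `|z i| ^+ 2 by rewrite lerXn2r ?nnegrE.
  rewrite -natr1; nra.
(* The vector [x] is rounded against the functional given by [y], and then [y] against the one given
   by the already rounded [U], so neither move decreases the form. *)
have [u [u1 u2 u3]] := lattice_round_fun R n n.+1 S x (fun i => \sum_j xi i j * y j)
   xS (bnd _ _ xs) xs.
pose U i := lattice_value R n.+1 (u i).
have [v [v1 v2 v3]] := lattice_round_fun R n n.+1 T y (fun j => \sum_i xi i j * U i)
   yT (bnd _ _ yt) yt.
pose V i := lattice_value R n.+1 (v i).
have le1 : bilin R n xi x y <= bilin R n xi U y.
  have E z : bilin R n xi z y = \sum_i (\sum_j xi i j * y j) * z i.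
    rewrite /bilin; apply: eq_bigr => i _; rewrite mulr_suml.
    by apply: eq_bigr => j _; ring.
  by rewrite !E.
have le2 : bilin R n xi U y <= bilin R n xi U V.
  have E z : bilin R n xi U z = \sum_j (\sum_i xi i j * U i) * z j.
    rewrite /bilin exchange_big/=; apply: eq_bigr => i _; rewrite mulr_suml.
    by apply: eq_bigr => j _; ring.
  by rewrite !E.
have wu := lattice_weight_ge R n n.+1 S u u1.
have wv := lattice_weight_ge R n n.+1 T v v1.
have term_le : lattice_weight R n n.+1 S u * lattice_weight R n n.+1 T v *
    lattice_term R n n.+1 K l xi u v <= expR N.
  apply: le_trans ZN; rewrite /lattice_sum (bigD1 u)//= (bigD1 v)//= -addrA lerDl.
  apply: addr_ge0; first apply: sumr_ge0 => v' _.
    by rewrite !mulr_ge0 ?lattice_weight_ge0 ?expR_ge0.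
  apply: sumr_ge0 => u' _; apply: sumr_ge0 => v' _.
  by rewrite !mulr_ge0 ?lattice_weight_ge0 ?expR_ge0.
have {}term_le : expR (- (\sum_i U i ^+ 2 + 2 * #|S|%:R)) *
   expR (- (\sum_i V i ^+ 2 + 2 * #|T|%:R)) * lattice_term R n n.+1 K l xi u v <= expR N.
  apply: le_trans term_le; rewrite ler_wpM2r ?expR_ge0//.
  by apply: ler_pM; rewrite ?expR_ge0.
rewrite /lattice_term -!expRD ler_expR -/U -/V in term_le.
have u0 : 0 <= \sum_i U i ^+ 2 by apply: sumr_ge0 => i _; exact: sqr_ge0.
have v0 : 0 <= \sum_i V i ^+ 2 by apply: sumr_ge0 => i _; exact: sqr_ge0.
have uv : (\sum_i U i ^+ 2) * (\sum_i V i ^+ 2) <= 4 * #|S|%:R * (4 * #|T|%:R).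
  exact: ler_pM.
have : K * l ^+ 2 * ((\sum_i U i ^+ 2) * (\sum_i V i ^+ 2)) <=
   K * l ^+ 2 * (4 * #|S|%:R * (4 * #|T|%:R)).
  by rewrite ler_wpM2l// mulr_ge0// sqr_ge0.
have : l * bilin R n xi x y <= l * bilin R n xi U V.
  by rewrite ler_wpM2l ?(ltW l0)//; exact: le_trans le1 le2.
move: u3 v3; rewrite -/U -/V => u3 v3.
lra.
Qed.

Lemma lattice_sum_expectation d (T : measurableType d) (R : realType)
    (P : probability T R) n M (K l : R) (A B : {set 'I_n})
    (Xi : T -> 'I_n -> 'I_n -> R) :
  (forall i j, measurable_fun setT (fun w => Xi w i j)) ->
  (forall a : 'I_n -> 'I_n -> R,
   (\int[P]_w (expR (\sum_i \sum_j a i j * Xi w i j))%:E <=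
     (expR (K * \sum_i \sum_j a i j ^+ 2))%:E)%E) ->
  measurable_fun setT (fun w => lattice_sum R n M K l A B (Xi w)) /\
  (\int[P]_w (lattice_sum R n M K l A B (Xi w))%:E <= 1)%E.
Proof.
move=> mXi mgf.
have mt u v : measurable_fun setT (fun w => lattice_term R n M K l (Xi w) u v).
  apply: measurableT_comp => //; apply: measurable_funB => //.
  apply: measurable_funM => //; apply: measurable_sum => i; apply: measurable_sum => j.
  by apply: measurable_funM => //; apply: measurable_funM.
have t0 w u v : 0 <= lattice_term R n M K l (Xi w) u v by exact: expR_ge0.
have w0 S u := lattice_weight_ge0 R n M S u.
have mwt u v : measurable_fun setT (fun w => lattice_weight R n M A u *
    lattice_weight R n M B v * lattice_term R n M K l (Xi w) u v).
  exact: measurable_funM.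
split.
  by apply: measurable_sum => u; apply: measurable_sum => v.
have It u v : (\int[P]_w (lattice_term R n M K l (Xi w) u v)%:E <= 1)%E.
  set U := fun i => lattice_value R M (u i).
  set V := fun i => lattice_value R M (v i).
  (* A rank-one array: its sum of squares factors and cancels exactly against the normalisation. *)
  pose a i j := l * (U i * V j).
  pose e := K * l ^+ 2 * ((\sum_i U i ^+ 2) * (\sum_j V j ^+ 2)).
  have Ea : K * \sum_i \sum_j a i j ^+ 2 = e.
    rewrite /e -mulrA; congr (_ * _); rewrite mulr_suml mulr_sumr.
    apply: eq_bigr => i _; rewrite !mulr_sumr; apply: eq_bigr => j _.
    by rewrite /a; ring.
  have := mgf a; rewrite Ea => h.
  rewrite (eq_integral (fun w => (expR (- e))%:E *
     (expR (\sum_i \sum_j a i j * Xi w i j))%:E)%E); last first.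
    move=> w _; rewrite -EFinM -expRD addrC; congr ((expR _)%:E).
    rewrite /lattice_term -/U -/V -/e /bilin; congr (_ - _).
    rewrite mulr_sumr; apply: eq_bigr => i _; rewrite mulr_sumr.
    by apply: eq_bigr => j _; rewrite /a; ring.
  rewrite ge0_integralZl_EFin//; last first.
    apply/measurable_EFinP; apply: measurableT_comp => //.
    by apply: measurable_sum => i; apply: measurable_sum => j; apply: measurable_funM.
  apply: (@le_trans _ _ ((expR (- e))%:E * (expR e)%:E)%E).
    by rewrite lee_pmul2l// lte_fin expR_gt0.
  by rewrite -EFinM mulrC expRxMexpNx_1.
have I2 u : (\int[P]_w (\sum_v lattice_weight R n M A u *
    lattice_weight R n M B v * lattice_term R n M K l (Xi w) u v)%:E <=
    (\sum_v lattice_weight R n M A u * lattice_weight R n M B v)%:E)%E.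
  under eq_integral do rewrite -sumEFin.
  rewrite ge0_integral_sum//; [|by move=> v; apply/measurable_EFinP|
    by move=> v w _; rewrite lee_fin !mulr_ge0].
  rewrite -sumEFin; apply: lee_sum => v _.
  under eq_integral do rewrite EFinM.
  rewrite ge0_integralZl_EFin//; [|by move=> w _; rewrite lee_fin
    |by apply/measurable_EFinP|exact: mulr_ge0].
  by rewrite -[leRHS]mule1 lee_wpmul2l// lee_fin mulr_ge0.
rewrite /lattice_sum; under eq_integral do rewrite -sumEFin.
rewrite ge0_integral_sum//;
  [|by move=> u; apply/measurable_EFinP; apply: measurable_sum => v
   |by move=> u w _; rewrite lee_fin; apply: sumr_ge0 => v _; rewrite !mulr_ge0].
apply: (@le_trans _ _ (\sum_u (\sum_v lattice_weight R n M A u * lattice_weight R n M B v)%:E)%E).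
  exact: lee_sum.
rewrite sumEFin lee_fin.
under eq_bigr do rewrite -mulr_sumr.
rewrite -mulr_suml; apply: mulr_ile1; rewrite ?sum_lattice_weight_le1//.
- by apply: sumr_ge0.
- by apply: sumr_ge0.
Qed.

(** * Summation over dyadic blocks *)

Lemma sum_cauchy_schwarz (R : realType) (I : finType) (a b : I -> R) :
  \sum_i a i * b i <= Num.sqrt (\sum_i a i ^+ 2) * Num.sqrt (\sum_i b i ^+ 2).
Proof.
have sa : 0 <= \sum_i a i ^+ 2 by apply: sumr_ge0 => i _; exact: sqr_ge0.
have sb : 0 <= \sum_i b i ^+ 2 by apply: sumr_ge0 => i _; exact: sqr_ge0.
rewrite -sqrtrM//; apply: le_trans (ler_norm _) _.
rewrite -sqrtr_sqr ler_sqrt; last by rewrite mulr_ge0.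
(* Lagrange's identity. *)
have : 0 <= \sum_i \sum_j (a i * b j - a j * b i) ^+ 2.
  by apply: sumr_ge0 => i _; apply: sumr_ge0 => j _; exact: sqr_ge0.
have -> : \sum_i \sum_j (a i * b j - a j * b i) ^+ 2 =
    2 * ((\sum_i a i ^+ 2) * (\sum_i b i ^+ 2)) - 2 * (\sum_i a i * b i) ^+ 2.
  have E1 : (\sum_i a i ^+ 2) * (\sum_i b i ^+ 2) =
      \sum_i \sum_j a i ^+ 2 * b j ^+ 2.
    by rewrite mulr_suml; apply: eq_bigr => i _; rewrite mulr_sumr.
  have E2 : (\sum_i a i ^+ 2) * (\sum_i b i ^+ 2) =
      \sum_i \sum_j a j ^+ 2 * b i ^+ 2.
    by rewrite E1 exchange_big.
  have E3 : (\sum_i a i * b i) ^+ 2 = \sum_i \sum_j a i * b i * (a j * b j).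
    by rewrite expr2 mulr_suml; apply: eq_bigr => i _; rewrite mulr_sumr.
  have -> : 2 * ((\sum_i a i ^+ 2) * (\sum_i b i ^+ 2)) =
      \sum_i \sum_j a i ^+ 2 * b j ^+ 2 + \sum_i \sum_j a j ^+ 2 * b i ^+ 2.
    by rewrite -E1 -E2; ring.
  rewrite E3 -big_split mulr_sumr -sumrB; apply: eq_bigr => i _.
  rewrite mulr_sumr /= -big_split -sumrB; apply: eq_bigr => j _ /=; ring.
lra.
Qed.

Lemma bilinZ (R : realType) n xi (a b : R) (x y : 'I_n -> R) :
  bilin R n xi (fun i => a * x i) (fun j => b * y j) = a * b * bilin R n xi x y.
Proof.
rewrite /bilin mulr_sumr; apply: eq_bigr => i _; rewrite mulr_sumr.
by apply: eq_bigr => j _; ring.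
Qed.

Lemma bilin0l (R : realType) n xi (x y : 'I_n -> R) :
  (forall i, x i = 0) -> bilin R n xi x y = 0.
Proof.
by move=> x0; rewrite /bilin big1// => i _; rewrite big1// => j _; rewrite x0 mulr0 mul0r.
Qed.

Lemma bilin0r (R : realType) n xi (x y : 'I_n -> R) :
  (forall i, y i = 0) -> bilin R n xi x y = 0.
Proof.
by move=> y0; rewrite /bilin big1// => i _; rewrite big1// => j _; rewrite y0 mulr0.
Qed.

Lemma sum_sqr_eq0 (R : realType) (I : finType) (x : I -> R) :
  \sum_i x i ^+ 2 = 0 -> forall i, x i = 0.
Proof.
move=> /eqP; rewrite psumr_eq0; last by move=> i _; exact: sqr_ge0.
by move=> /allP h i; apply/eqP; rewrite -sqrf_eq0; apply: h; rewrite mem_index_enum.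
Qed.

(** The rate [l] at which l^2 s t, the quadratic cost for vectors of norms [sqrt s] and [sqrt t],
    equals the entropy cost s + t + log n. It is 0 if a block is empty, where the form vanishes
    anyway. *)
Definition block_scale (R : realType) n (S T : {set 'I_n}) : R :=
  Num.sqrt ((#|S|%:R + #|T|%:R + ln n%:R) / (#|S|%:R * #|T|%:R)).

(** With L = s + t + log n, the scaled form times the rate is at most (16 K + 6) L. Dividing by the
    rate leaves [sqrt (L s t)], and undoing the scaling removes [sqrt (s t)]. *)
Lemma bilin_block_le (R : realType) n (K : R) (S T : {set 'I_n}) xi
    (x y : 'I_n -> R) :
  0 <= K -> (0 < n)%N ->
  (forall i, i \notin S -> x i = 0) -> (forall i, i \notin T -> y i = 0) ->
  lattice_sum R n n.+1 K (block_scale R n S T) S T xi <= n%:R ^+ 6 ->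
  bilin R n xi x y <= (16 * K + 6) *
    (Num.sqrt (#|S|%:R + #|T|%:R + ln n%:R) *
      (Num.sqrt (\sum_i x i ^+ 2) * Num.sqrt (\sum_i y i ^+ 2))).
Proof.
move=> K0 n0 xS yT HZ.
set s : R := #|S|%:R; set t : R := #|T|%:R; set l : R := ln n%:R.
set X := Num.sqrt (\sum_i x i ^+ 2); set Y := Num.sqrt (\sum_i y i ^+ 2).
set L := s + t + l.
have l0 : 0 <= l by rewrite ln_ge0// ler1n.
have s0 : 0 <= s by [].
have t0 : 0 <= t by [].
have sx : 0 <= \sum_i x i ^+ 2 by apply: sumr_ge0 => i _; exact: sqr_ge0.
have sy : 0 <= \sum_i y i ^+ 2 by apply: sumr_ge0 => i _; exact: sqr_ge0.
have X0 : 0 <= X := sqrtr_ge0 _.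
have Y0 : 0 <= Y := sqrtr_ge0 _.
have rhs0 : 0 <= (16 * K + 6) * (Num.sqrt L * (X * Y)).
  by rewrite !mulr_ge0 ?sqrtr_ge0// addr_ge0// mulr_ge0.
have [X_eq0|Xn0] := eqVneq X 0.
  rewrite bilin0l//; apply: sum_sqr_eq0; apply/eqP; rewrite eq_le sx andbT.
  by rewrite -sqrtr_eq0; apply/eqP.
have [Y_eq0|Yn0] := eqVneq Y 0.
  rewrite bilin0r//; apply: sum_sqr_eq0; apply/eqP; rewrite eq_le sy andbT.
  by rewrite -sqrtr_eq0; apply/eqP.
have Xp : 0 < X by rewrite lt_neqAle eq_sym Xn0.
have Yp : 0 < Y by rewrite lt_neqAle eq_sym Yn0.
have card_gt0 (U : {set 'I_n}) (z : 'I_n -> R) : (forall i, i \notin U -> z i = 0) ->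
    Num.sqrt (\sum_i z i ^+ 2) != 0 -> 0 < #|U|%:R :> R.
  move=> zU; rewrite ltr0n card_gt0; apply: contra_neq => U0.
  by rewrite big1 ?sqrtr0// => i _; rewrite zU ?expr0n// U0 inE.
have sp : 0 < s by exact: (card_gt0 _ _ xS).
have tp : 0 < t by exact: (card_gt0 _ _ yT).
have Lp : 0 < L by rewrite /L; lra.
have stp : 0 < s * t by exact: mulr_gt0.
set la := block_scale R n S T in HZ.
have lap : 0 < la by rewrite sqrtr_gt0 divr_gt0.
have la2 : la ^+ 2 = L / (s * t) by rewrite sqr_sqrtr// divr_ge0// ltW.
have EN : n%:R ^+ 6 = expR (6 * l).
  by rewrite expRM_natl lnK// posrE ltr0n.
rewrite EN in HZ.
have scale (U : R) (z : 'I_n -> R) : 0 <= U -> Num.sqrt (\sum_i z i ^+ 2) != 0 ->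
   \sum_i (Num.sqrt U / Num.sqrt (\sum_i z i ^+ 2) * z i) ^+ 2 <= U.
  move=> U0 zn0; under eq_bigr do rewrite exprMn.
  have z0 : 0 <= \sum_i z i ^+ 2 by apply: sumr_ge0 => i _; exact: sqr_ge0.
  rewrite -mulr_sumr -{2}(sqr_sqrtr z0) -exprMn -mulrA mulVf// mulr1.
  by rewrite sqr_sqrtr.
have := @bilin_le_lattice R n K la (6 * l) S T xi
  (fun i => Num.sqrt s / X * x i) (fun i => Num.sqrt t / Y * y i) K0 lap _ _ _ _ HZ.
have xS' i : i \notin S -> Num.sqrt s / X * x i = 0 by move=> /xS ->; rewrite mulr0.
have yT' i : i \notin T -> Num.sqrt t / Y * y i = 0 by move=> /yT ->; rewrite mulr0.
move=> /(_ xS' yT' (scale _ _ s0 Xn0) (scale _ _ t0 Yn0)).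
rewrite bilinZ la2 -/s -/t.
have -> : 16 * K * (L / (s * t)) * (s * t) = 16 * K * L.
  by field; rewrite !gt_eqF.
move=> H.
have {}H : la * (Num.sqrt s / X * (Num.sqrt t / Y) * bilin R n xi x y) <=
    (16 * K + 6) * L by apply: le_trans H _; rewrite /L; lra.
have Lla : Num.sqrt L = la * (Num.sqrt s * Num.sqrt t).
  rewrite -sqrtrM// /la /block_scale -/s -/t -/l -/L.
  by rewrite -sqrtrM ?divr_ge0 ?(ltW Lp) ?(ltW stp)// divfK// gt_eqF.
have LL : L = Num.sqrt L * Num.sqrt L by rewrite -expr2 sqr_sqrtr// ltW.
have XY : 0 < X * Y by exact: mulr_gt0.
have -> : (16 * K + 6) * (Num.sqrt L * (X * Y)) = ((16 * K + 6) * Num.sqrt L) * (X * Y) by ring.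
rewrite -ler_pdivrMr//.
have sLp : 0 < Num.sqrt L by rewrite sqrtr_gt0.
rewrite -(ler_pM2l sLp) (mulrC _ ((16 * K + 6) * _)) -mulrA -LL.
apply: le_trans H; rewrite {1}Lla le_eqVlt; apply/orP; left; apply/eqP.
by field; rewrite Xn0 Yn0.
Qed.

Lemma dyadic_level (R : realType) (w W : R) : 0 < w -> w <= W ->
  exists l : nat, w <= W * 2^-1 ^+ l /\ W * 2^-1 ^+ l <= 2 * w.
Proof.
move=> w0 wW; have W0 : 0 < W by exact: lt_le_trans wW.
have ex : exists l, W * 2^-1 ^+ l.+1 < w.
  exists (Num.truncn (W / w)); rewrite exprVn ltr_pdivrMr ?exprn_gt0//.
  rewrite mulrC -ltr_pdivrMr//.
  apply: lt_le_trans (truncnS_gt _) _; rewrite -natrX ler_nat.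
  exact: ltnW (ltn_expl _ _).
(* The least l with W 2^-(l+1) < w: minimality gives w <= W 2^-l, and for l = 0 this is the
   hypothesis w <= W. *)
case: (ex_minnP ex) => l Pl lmin; exists l; split; last first.
  by move: Pl; rewrite exprS; lra.
case: l Pl lmin => [|l] Pl lmin; first by rewrite expr0 mulr1.
by rewrite leNgt; apply/negP => /lmin; rewrite ltnn.
Qed.

Lemma sqrtrD_le (R : realType) (a b : R) : 0 <= a -> 0 <= b ->
  Num.sqrt (a + b) <= Num.sqrt a + Num.sqrt b.
Proof.
move=> a0 b0.
have sa := sqrtr_ge0 a; have sb := sqrtr_ge0 b.
rewrite -(@ler_pXn2r _ 2)// ?nnegrE ?sqrtr_ge0 ?addr_ge0//.
rewrite sqrrD !sqr_sqrtr ?addr_ge0//.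
have : 0 <= Num.sqrt a * Num.sqrt b by exact: mulr_ge0.
lra.
Qed.

Lemma sum_geometric_half_le2 (R : realType) N :
  \sum_(l < N) 2^-1 ^+ l <= 2 :> R.
Proof.
have h := subrX1 (2^-1 : R) N.
have h0 : 0 <= 2^-1 ^+ N :> R by rewrite exprn_ge0.
lra.
Qed.

(** For w = 1/mu this is the norm of the diagonal form of [mu]. *)
Definition wnorm (R : realType) n (w x : 'I_n -> R) : R :=
  Num.sqrt (\sum_i x i ^+ 2 / w i).

Definition restr (R : realType) n (lev : 'I_n -> nat) (l : nat) (x : 'I_n -> R) i : R :=
  if lev i == l then x i else 0.

Lemma sum_restr_levels (R : realType) n (lev : 'I_n -> nat) N (f : 'I_n -> R) :
  (forall i, (lev i < N)%N) ->
  \sum_(l < N) \sum_i (if lev i == l then f i else 0) = \sum_i f i.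
Proof.
move=> levN; rewrite exchange_big/=; apply: eq_bigr => i _.
rewrite (bigD1 (Ordinal (levN i)))//= eqxx big1 ?addr0// => l.
by rewrite -val_eqE/= eq_sym => /negbTE ->.
Qed.

Lemma bilin_levels (R : realType) n (lev : 'I_n -> nat) N xi (x y : 'I_n -> R) :
  (forall i, (lev i < N)%N) ->
  bilin R n xi x y = \sum_(l < N) \sum_(m < N)
    bilin R n xi (restr R n lev l x) (restr R n lev m y).
Proof.
move=> levN.
have E z i : \sum_(l < N) restr R n lev l z i = z i.
  rewrite (bigD1 (Ordinal (levN i)))//= /restr eqxx big1 ?addr0// => l.
  by rewrite -val_eqE/= eq_sym => /negbTE ->.
rewrite /bilin; symmetry.
under eq_bigr do rewrite exchange_big/=.
rewrite exchange_big/=; apply: eq_bigr => i _.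
under eq_bigr do rewrite exchange_big/=.
rewrite exchange_big/=; apply: eq_bigr => j _.
rewrite -[in RHS](E x i) -[in RHS](E y j) [X in _ = X * _]mulr_sumr mulr_suml.
by apply: eq_bigr => l _; rewrite mulr_sumr.
Qed.

(** Splitting the root of s + t + l0 into three roots makes the double sum over levels factor into
    the single sums [X1] and [X2]. The first is summed by geometric decay, the second because s_l W
    2^-l is at most twice the sum of [w] over level l. The 10 is 4 + 4 + 2. *)
Lemma bilin_le_wnorm (R : realType) n (lev : 'I_n -> nat) (w : 'I_n -> R)
    (W B l0 kappa : R) xi (x y : 'I_n -> R) :
  0 <= B -> 4^-1 <= l0 -> 0 <= kappa -> 0 <= W -> W <= \sum_i w i ->
  l0 * W * \sum_i w i <= kappa ^+ 2 ->
  (forall i, 0 < w i) ->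
  (forall i, w i <= W * 2^-1 ^+ lev i /\ W * 2^-1 ^+ lev i <= 2 * w i) ->
  (forall l m (x' y' : 'I_n -> R),
     (forall i, i \notin [set i | lev i == l]%SET -> x' i = 0) ->
     (forall i, i \notin [set i | lev i == m]%SET -> y' i = 0) ->
     bilin R n xi x' y' <= B *
       (Num.sqrt (#|[set i | lev i == l]%SET|%:R + #|[set i | lev i == m]%SET|%:R + l0) *
        (Num.sqrt (\sum_i x' i ^+ 2) * Num.sqrt (\sum_i y' i ^+ 2)))) ->
  bilin R n xi x y <= 10 * B * kappa * (wnorm R n w x * wnorm R n w y).
Proof.
move=> B0 l04 k0 W0 Wsum Hk w0 Hlev Hblock.
have l00 : 0 <= l0 by lra.
pose N := (\max_i lev i).+1.
have levN i : (lev i < N)%N by rewrite ltnS; exact: (leq_bigmax i).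
pose s l : R := #|[set i | lev i == l]%SET|%:R.
have s0 l : 0 <= s l by [].
pose p l : R := Num.sqrt (W * 2^-1 ^+ l).
have p0 l : 0 <= p l by exact: sqrtr_ge0.
have W2 l : 0 <= W * 2^-1 ^+ l by rewrite mulr_ge0// exprn_ge0.
pose al (z : 'I_n -> R) l := Num.sqrt (\sum_i (if lev i == l then z i ^+ 2 / w i else 0)).
have sal z l : 0 <= \sum_i (if lev i == l then z i ^+ 2 / w i else 0).
  by apply: sumr_ge0 => i _; case: ifP => // _; rewrite divr_ge0 ?sqr_ge0// ltW.
have al0 z l : 0 <= al z l by exact: sqrtr_ge0.
have restr_le z l : Num.sqrt (\sum_i restr R n lev l z i ^+ 2) <= p l * al z l.
  rewrite -sqrtrM// ler_wsqrtr// mulr_sumr; apply: ler_sum => i _.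
  rewrite /restr; case: eqP => [<-|_]; last by rewrite expr0n/= mulr0.
  rewrite mulrA ler_pdivlMr// mulrC ler_wpM2r ?sqr_ge0//.
  by have [] := Hlev i.
have sum_al z : \sum_(l < N) al z l ^+ 2 = \sum_i z i ^+ 2 / w i.
  under eq_bigr do rewrite sqr_sqrtr//.
  exact: sum_restr_levels.
have A0 z : 0 <= wnorm R n w z by exact: sqrtr_ge0.
pose X1 z := \sum_(l < N) p l * al z l.
pose X2 z := \sum_(l < N) Num.sqrt (s l) * (p l * al z l).
have X10 z : 0 <= X1 z by apply: sumr_ge0 => l _; rewrite mulr_ge0.
have X20 z : 0 <= X2 z by apply: sumr_ge0 => l _; rewrite !mulr_ge0 ?sqrtr_ge0.
have X1le z : X1 z <= Num.sqrt (2 * W) * wnorm R n w z.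
  apply: le_trans (sum_cauchy_schwarz _ _ _ _) _; rewrite sum_al.
  rewrite ler_wpM2r ?sqrtr_ge0// ler_wsqrtr//.
  under eq_bigr do rewrite sqr_sqrtr//.
  rewrite -mulr_sumr mulrC ler_wpM2r//; exact: sum_geometric_half_le2.
have X2le z : X2 z <= Num.sqrt (2 * \sum_i w i) * wnorm R n w z.
  rewrite /X2; under eq_bigr do rewrite mulrA.
  apply: le_trans (sum_cauchy_schwarz _ _ _ _) _; rewrite sum_al.
  rewrite ler_wpM2r ?sqrtr_ge0// ler_wsqrtr//.
  under eq_bigr do rewrite exprMn !sqr_sqrtr//.
  have E l : s l * (W * 2^-1 ^+ l) = \sum_i (if lev i == l then W * 2^-1 ^+ lev i else 0).
    rewrite -big_mkcond/= (eq_bigr (fun=> W * 2^-1 ^+ l)); last by move=> i /eqP ->.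
    by rewrite sumr_const /s cardsE mulr_natl.
  under eq_bigr do rewrite E.
  rewrite (sum_restr_levels R n lev N (fun i => W * 2^-1 ^+ lev i))// mulr_sumr.
  by apply: ler_sum => i _; have [] := Hlev i.
have main : bilin R n xi x y <=
    B * (X2 x * X1 y + X1 x * X2 y + Num.sqrt l0 * (X1 x * X1 y)).
  rewrite (bilin_levels R n lev N)//.
  apply: (@le_trans _ _ (\sum_(l < N) \sum_(m < N)
     B * ((Num.sqrt (s l) + Num.sqrt (s m) + Num.sqrt l0) *
        ((p l * al x l) * (p m * al y m))))).
    apply: ler_sum => l _; apply: ler_sum => m _.
    apply: le_trans (Hblock l m _ _ _ _) _.
    - by move=> i; rewrite inE /restr => /negbTE ->.
    - by move=> i; rewrite inE /restr => /negbTE ->.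
    rewrite ler_wpM2l//; apply: ler_pM; rewrite ?mulr_ge0 ?sqrtr_ge0//.
      apply: le_trans (sqrtrD_le _ _ _ _ _) _; rewrite ?addr_ge0//.
      by rewrite lerD2r sqrtrD_le.
    by apply: ler_pM; rewrite ?sqrtr_ge0.
  rewrite le_eqVlt; apply/orP; left; apply/eqP.
  rewrite /X1 /X2 !mulr_suml mulr_sumr -!big_split/= mulr_sumr.
  apply: eq_bigr => l _.
  rewrite !mulr_sumr -!big_split/= mulr_sumr; apply: eq_bigr => m _; ring.
set A := wnorm R n w x in X1le X2le *; set A' := wnorm R n w y.
set a1 := Num.sqrt (2 * W) in X1le; set a2 := Num.sqrt (2 * \sum_i w i) in X2le.
have a10 : 0 <= a1 := sqrtr_ge0 _.
have a20 : 0 <= a2 := sqrtr_ge0 _.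
have sw0 : 0 <= \sum_i w i by exact: le_trans Wsum.
(* The mixed terms carry no logarithm; l0 >= 1/4 supplies the one in the budget. *)
have h12 : a1 * a2 <= 4 * kappa.
  rewrite -sqrtrM ?mulr_ge0// -[leRHS](@ger0_norm _ (4 * kappa)) ?mulr_ge0//.
  rewrite -sqrtr_sqr ler_wsqrtr// exprMn.
  have : 4^-1 * (W * \sum_i w i) <= l0 * (W * \sum_i w i) by rewrite ler_wpM2r// mulr_ge0.
  lra.
(* Here W <= sum w bounds l0 W^2 by the budget. *)
have h11 : Num.sqrt l0 * (a1 * a1) <= 2 * kappa.
  rewrite /a1 -expr2 sqr_sqrtr ?mulr_ge0//.
  have -> : Num.sqrt l0 * (2 * W) = 2 * (Num.sqrt l0 * W) by ring.
  rewrite ler_pM2l// -(@ler_pXn2r _ 2)// ?nnegrE ?mulr_ge0 ?sqrtr_ge0//.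
  rewrite exprMn sqr_sqrtr//; apply: le_trans Hk.
  by rewrite -mulrA ler_wpM2l// expr2 ler_wpM2l.
have H1 : X2 x * X1 y <= a2 * A * (a1 * A') by exact: ler_pM.
have H2 : X1 x * X2 y <= a1 * A * (a2 * A') by exact: ler_pM.
have H3 : Num.sqrt l0 * (X1 x * X1 y) <= Num.sqrt l0 * (a1 * A * (a1 * A')).
  by rewrite ler_wpM2l ?sqrtr_ge0//; exact: ler_pM.
apply: le_trans main _.
have -> : 10 * B * kappa * (A * A') = B * (10 * kappa * (A * A')) by ring.
rewrite ler_wpM2l//.
have AA : 0 <= A * A' by rewrite mulr_ge0 ?A0.
have : (a1 * a2) * (A * A') <= 4 * kappa * (A * A') by rewrite ler_wpM2r.
have : (Num.sqrt l0 * (a1 * a1)) * (A * A') <= 2 * kappa * (A * A') by rewrite ler_wpM2r.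
lra.
Qed.

(** * The weight budget *)

Lemma ln_ge_quarter (R : realType) n : (2 <= n)%N -> 4^-1 <= ln n%:R :> R.
Proof.
move=> n2; have n0 : 0 < n%:R :> R by rewrite ltr0n; exact: leq_trans n2.
rewrite -ler_expR lnK ?posrE//.
apply: (@le_trans _ _ 2); last by rewrite ler_nat.
have h1 : 1 + - 4^-1 <= expR (- 4^-1) :> R := expR_ge1Dx _.
have h2 := expRxMexpNx_1 (4^-1 : R).
have h3 := expR_gt0 (4^-1 : R).
nra.
Qed.

(** Young's inequality is applied to w_i / A and 1, with A normalised so that the numbers (w_i /
    A)^r have mean 1; the right-hand sides then sum to n. *)
Lemma lr_norm_power_mean (R : realType) n (r : R) (w : 'I_n -> R) :
  (0 < n)%N -> 1 < r -> (forall i, 0 < w i) ->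
  \sum_i w i <= n%:R `^ (1 - r^-1) * lr_norm r w.
Proof.
move=> n0 r1 w0.
have r0 : 0 < r by exact: lt_trans r1.
have nR : 0 < n%:R :> R by rewrite ltr0n.
pose S := \sum_i w i `^ r.
have SE : lr_norm r w = S `^ r^-1.
  by rewrite /lr_norm; congr (_ `^ _); apply: eq_bigr => i _; rewrite gtr0_norm.
have S0 : 0 < S.
  rewrite /S (bigD1 (Ordinal n0))//=; apply: ltr_pwDl; first exact: powR_gt0.
  by apply: sumr_ge0 => i _; exact: powR_ge0.
have SD : \sum_i w i `^ r = S by [].
rewrite SE; clearbody S; set N := S `^ r^-1.
have N0 : 0 < N by exact: powR_gt0.
have rn0 : r != 0 by rewrite gt_eqF.
have Nr : N `^ r = S by rewrite /N -powRrM (mulVf rn0) (powRr1 (ltW S0)).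
clearbody N.
pose A := N * n%:R `^ (- r^-1).
have A0 : 0 < A by rewrite mulr_gt0// powR_gt0.
have Ar : A `^ r = S / n%:R.
  rewrite /A powRM ?(ltW N0) ?powR_ge0// Nr -powRrM mulNr mulVf ?gt_eqF//.
  by rewrite powR_inv1// ltW.
have young i : w i / A <= (w i `^ r) * (n%:R / S) / r + (1 - r^-1).
  have q0 : 0 < 1 - r^-1 by rewrite subr_gt0 invf_lt1.
  have := @conjugate_powR R (w i / A) 1 r (1 - r^-1)^-1.
  rewrite divr_ge0 ?(ltW (w0 i)) ?(ltW A0)// ler01 r0 invr_gt0 q0 invrK.
  rewrite mulr1 powR1 mul1r addrCA subrr addr0 => /(_ isT isT isT isT erefl).
  rewrite powRM ?(ltW (w0 i)) ?invr_ge0 ?(ltW A0)//.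
  have -> : A^-1 `^ r = n%:R / S; last by [].
  rewrite -(powR_inv1 (ltW A0)) -powRrM mulN1r powRN Ar invfM invrK mulrC //.
have sumA : (\sum_i w i) / A <= n%:R.
  rewrite mulr_suml; apply: (@le_trans _ _ (\sum_i ((w i `^ r) * (n%:R / S) / r + (1 - r^-1)))).
    by apply: ler_sum => i _; exact: young.
  rewrite big_split/= -!mulr_suml SD sumr_const card_ord -[X in _ + X]mulr_natr.
  rewrite le_eqVlt; apply/orP; left; apply/eqP.
  by field; rewrite !gt_eqF.
move: sumA; rewrite ler_pdivrMr// => /le_trans; apply.
rewrite /A mulrA (mulrC n%:R) -mulrA (mulrC _ N) ler_pM2l//.
rewrite powRD; last by apply/implyP => _; rewrite gt_eqF.
by rewrite (powRr1 (ltW nR)).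
Qed.

(** For r = p / (p - 2) one has 1 - 1/r = 2/p, so max w * sum w is at most n^(2/p) times the square
    of the r-norm, and the factor p >= 2 is dropped. In the second alternative max w <= sum w, and
    log n >= 1/4 costs the factor 4 in (2 c)^2. *)
Lemma assumption2_budget (R : realType) n (c : R) (mu : 'I_n -> R) :
  (2 <= n)%N -> 0 <= c -> (forall i, 0 < mu i) -> assumption2 c mu ->
  exists W : R, [/\ forall i, (mu i)^-1 <= W, 0 <= W, W <= \sum_i (mu i)^-1 &
    ln n%:R * W * (\sum_i (mu i)^-1) <= (2 * c) ^+ 2].
Proof.
move=> n2 c0 mu0.
have n0 : (0 < n)%N by exact: leq_trans n2.
have nR : 0 < n%:R :> R by rewrite ltr0n.
pose w i := (mu i)^-1.
have w0 i : 0 < w i by rewrite invr_gt0.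
have l4 := ln_ge_quarter R n n2; set l := ln n%:R in l4 *.
pose i0 : 'I_n := Ordinal n0.
pose im := [arg max_(i > i0) w i]%O.
have Wmax i : w i <= w im.
  by rewrite /im; case: arg_maxP => // j _ /(_ i isT).
have WS : w im <= \sum_i w i.
  by rewrite (bigD1 im)//= lerDl sumr_ge0// => i _; exact: ltW.
have W0 := ltW (w0 im).
move=> hyp; exists (w im); split => //.
rewrite -/(\sum_i w i); set S := \sum_i w i in WS *.
have S0 : 0 <= S by exact: le_trans WS.
have normE (r : R) : 1 < r -> w im <= lr_norm r w.
  move=> r1; have r0 : 0 < r by exact: lt_trans r1.
  rewrite /lr_norm -{1}(powRr1 W0) -{1}(@mulfV _ r) ?gt_eqF// powRrM.
  apply: ge0_ler_powR; rewrite ?nnegrE ?invr_ge0 ?powR_ge0 ?(ltW r0)//.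
    by apply: sumr_ge0 => i _; exact: powR_ge0.
  rewrite (bigD1 im)//= gtr0_norm// lerDl.
  by apply: sumr_ge0 => i _; exact: powR_ge0.
case: hyp => [[p [p2]]|].
  set m := n%:R `^ p^-1; set V := norm_pp2 _ _ => H.
  have m0 : 0 <= m by exact: powR_ge0.
  have VW : 0 <= V /\ w im * S <= m ^+ 2 * V ^+ 2.
    (* At p = 2 the norm is the maximum, and sum w <= n max w replaces the power mean inequality. *)
    rewrite /V /norm_pp2; case: eqP => [pE|/eqP pn2].
      have WV : w im <= linf_norm (ddiag_inv mu).
        rewrite /linf_norm /ddiag_inv; apply: le_trans (ler_norm _) _.
        exact: (le_bigmax_cond _ (fun i => `|(mu i)^-1|)).
      split; first exact: le_trans WV.
      have -> : m ^+ 2 = n%:R.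
        have two0 : 2 != 0 :> R by rewrite pnatr_eq0.
        by rewrite /m pE -(powR_mulrn 2 (powR_ge0 _ _)) -powRrM (mulVf two0) (powRr1 (ltW nR)).
      have SnW : S <= n%:R * w im.
        rewrite /S mulr_natl -[X in _ <= _ *+ X]card_ord -sumr_const.
        by apply: ler_sum => i _.
      apply: (@le_trans _ _ (n%:R * w im ^+ 2)).
        by rewrite expr2 mulrA (mulrC (w im)) ler_wpM2r.
      by rewrite ler_wpM2l ?(ltW nR)// lerXn2r ?nnegrE// (le_trans W0).
    have p_gt2 : 2 < p by rewrite lt_neqAle eq_sym pn2.
    set r := p / (p - 2).
    have p20 : 0 < p - 2 by rewrite subr_gt0.
    have r1 : 1 < r by rewrite /r ltr_pdivlMr//; lra.
    have WV := normE r r1; split; first exact: le_trans WV.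
    have := lr_norm_power_mean R n r w n0 r1 w0.
    have -> : n%:R `^ (1 - r^-1) = m ^+ 2.
      rewrite /m -powR_mulrn ?powR_ge0// -powRrM; congr (_ `^ _).
      by rewrite /r; field; rewrite !gt_eqF//; lra.
    move=> SV; rewrite -/S in SV.
    apply: (@le_trans _ _ (lr_norm r w * (m ^+ 2 * lr_norm r w))).
      exact: ler_pM.
    by rewrite le_eqVlt; apply/orP; left; apply/eqP; rewrite -/w /ddiag_inv; ring.
  have [V0 VV] := VW.
  have p0 : 0 <= p by lra.
  have l00 : 0 <= l by lra.
  have H2 : p * l * (m ^+ 2 * V ^+ 2) <= c ^+ 2.
    have -> : p * l * (m ^+ 2 * V ^+ 2) = (Num.sqrt (p * l) * m * V) ^+ 2.
      by rewrite !exprMn sqr_sqrtr ?mulr_ge0// mulrA.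
    by rewrite lerXn2r ?nnegrE ?mulr_ge0 ?sqrtr_ge0.
  have q0 : 0 <= m ^+ 2 * V ^+ 2 by rewrite mulr_ge0 ?sqr_ge0.
  have : l * (w im * S) <= l * (m ^+ 2 * V ^+ 2) by rewrite ler_wpM2l.
  have : l * (m ^+ 2 * V ^+ 2) <= p * l * (m ^+ 2 * V ^+ 2).
    by rewrite ler_wpM2r// ler_peMl//; lra.
  have : 0 <= c ^+ 2 by exact: sqr_ge0.
  rewrite exprMn; lra.
have -> : lr_norm 1 (ddiag_inv mu) = S.
  rewrite /lr_norm invr1 powRr1; last by apply: sumr_ge0 => i _; exact: powR_ge0.
  by apply: eq_bigr => i _; rewrite powRr1// gtr0_norm// /ddiag_inv -/(w i).
move=> H.
have l00 : 0 <= l by lra.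
have : (l * S) ^+ 2 <= c ^+ 2 by rewrite lerXn2r ?nnegrE// mulr_ge0.
have : l * w im * S <= l * S * S by rewrite ler_wpM2r// ler_wpM2l.
have : 4^-1 * (l * S * S) <= l * (l * S * S) by rewrite ler_wpM2r// !mulr_ge0.
rewrite !exprMn; nra.
Qed.

(** * Hermitian forms in real coordinates *)

Lemma Re_sum (R : realType) (I : finType) (f : I -> R[i]) :
  complex.Re (\sum_i f i) = \sum_i complex.Re (f i).
Proof. by apply: big_morph => // -[a b] [a' b']. Qed.

Lemma Im_sum (R : realType) (I : finType) (f : I -> R[i]) :
  complex.Im (\sum_i f i) = \sum_i complex.Im (f i).
Proof. by apply: big_morph => // -[a b] [a' b']. Qed.

Lemma sesqE (R : realType) n (z : 'cV[R[i]]_n) (A : 'M[R[i]]_n) :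
  sesq z A z = \sum_i \sum_j (conjc (z i 0) * A i j * z j 0).
Proof.
rewrite /sesq /ctr mxE exchange_big/=; apply: eq_bigr => j _.
rewrite mxE mulr_suml; apply: eq_bigr => i _.
by rewrite !mxE.
Qed.

Lemma Re_sesq (R : realType) n (z : 'cV[R[i]]_n) (A : 'M[R[i]]_n)
    (x := fun i => complex.Re (z i 0)) (y := fun i => complex.Im (z i 0)) :
  complex.Re (sesq z A z) = \sum_i \sum_j
    (complex.Re (A i j) * (x i * x j + y i * y j) -
     complex.Im (A i j) * (x i * y j - y i * x j)).
Proof.
rewrite sesqE Re_sum; apply: eq_bigr => i _; rewrite Re_sum; apply: eq_bigr => j _.
rewrite /x /y; case: (z i 0) (A i j) (z j 0) => [a b] [p q] [c d] /=; ring.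
Qed.

Lemma is_hermitianE (R : realType) n (A : 'M[R[i]]_n) i j :
  is_hermitian A -> complex.Re (A j i) = complex.Re (A i j) /\
    complex.Im (A j i) = - complex.Im (A i j).
Proof.
move=> HA; have := congr1 (fun M : 'M[R[i]]_n => M j i) HA; rewrite /ctr !mxE => <-.
by case: (A i j).
Qed.

Lemma Im_sesq_hermitian (R : realType) n (z : 'cV[R[i]]_n) (A : 'M[R[i]]_n) :
  is_hermitian A -> complex.Im (sesq z A z) = 0.
Proof.
move=> HA; set s := complex.Im _.
pose f i j := complex.Im (conjc (z i 0) * A i j * z j 0).
have sE : s = \sum_i \sum_j f i j.
  rewrite /s sesqE Im_sum; apply: eq_bigr => i _; exact: Im_sum.
have fN i j : f j i = - f i j.
  have [] := is_hermitianE R n A i j HA; rewrite /f.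
  case: (z i 0) (A i j) (A j i) (z j 0) => [a b] [p q] [p' q'] [c d] /= -> ->; ring.
suff : s = - s by lra.
rewrite {1}sE exchange_big/= sE -sumrN; apply: eq_bigr => i _.
by rewrite -sumrN; apply: eq_bigr => j _.
Qed.

(* Weights turning the sum of a symmetric array into a sum over [i <= j]. *)
Definition upper_coef (R : realType) n (i j : 'I_n) : R :=
  if (i < j)%N then 2 else if i == j then 1 else 0.

Lemma sum_upper_coef (R : realType) n (f : 'I_n -> 'I_n -> R) :
  (forall i j, f j i = f i j) ->
  \sum_i \sum_j f i j = \sum_i \sum_j upper_coef R n i j * f i j.
Proof.
move=> fC.
pose a (i j : 'I_n) := (if (i < j)%N then f i j else 0) + (if i == j then f i j else 0) +
   (if (j < i)%N then f i j else 0).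
have fE i j : f i j = a i j.
  rewrite /a -val_eqE/=; case: ltngtP => _; rewrite ?addr0 ?add0r//.
under eq_bigr do under eq_bigr do rewrite fE /a.
have E : \sum_(i < n) \sum_(j < n) (if (j < i)%N then f i j else 0) =
    \sum_(i < n) \sum_(j < n) (if (i < j)%N then f i j else 0).
  rewrite exchange_big/=; apply: eq_bigr => i _; apply: eq_bigr => j _.
  by rewrite fC.
under eq_bigr do rewrite big_split/=.
rewrite big_split/= E -big_split/=; apply: eq_bigr => i _.
rewrite -big_split/=; apply: eq_bigr => j _.
rewrite /upper_coef; case: ifPn => ij.
  by rewrite -val_eqE/= ltn_eqF// ; ring.
by case: ifP => _; ring.
Qed.

(** Only entries with i <= j, the independent ones, keep a nonzero coefficient. The minus sign of
    one imaginary form is moved into its vector, so that upper bounds on bilinear forms suffice. *)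
Lemma Re_sesq_hermitian (R : realType) n (z : 'cV[R[i]]_n) (A : 'M[R[i]]_n)
    (x := fun i => complex.Re (z i 0)) (y := fun i => complex.Im (z i 0))
    (re := fun i j => upper_coef R n i j * complex.Re (A i j))
    (im := fun i j => upper_coef R n i j * complex.Im (A i j)) :
  is_hermitian A ->
  complex.Re (sesq z A z) = bilin R n re x x + bilin R n re y y +
    (bilin R n im (fun i => -1 * x i) (fun j => 1 * y j) + bilin R n im y x).
Proof.
move=> HA; rewrite Re_sesq sum_upper_coef; last first.
  move=> i j; have [-> ->] := is_hermitianE R n A i j HA; ring.
rewrite /bilin -!big_split/=; apply: eq_bigr => i _; rewrite -!big_split/=.
by apply: eq_bigr => j _; rewrite /re /im /x /y; ring.
Qed.

Lemma Re_sesq_Dmu (R : realType) n (z : 'cV[R[i]]_n) (mu : 'I_n -> R) :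
  complex.Re (sesq z (Dmu mu) z) =
    \sum_i mu i * (complex.Re (z i 0) ^+ 2 + complex.Im (z i 0) ^+ 2).
Proof.
rewrite Re_sesq; apply: eq_bigr => i _; rewrite (bigD1 i)//= big1 ?addr0.
  by rewrite /Dmu !mxE eqxx/=; ring.
move=> j ji; rewrite /Dmu !mxE eq_sym (negbTE ji)/=; ring.
Qed.

Lemma Dmu_hermitian (R : realType) n (mu : 'I_n -> R) : is_hermitian (Dmu mu).
Proof.
rewrite /is_hermitian /ctr /Dmu; apply/matrixP => i j; rewrite !mxE eq_sym.
by case: eqP => [->|_]; rewrite ?mulr1n ?mulr0n /= ?oppr0.
Qed.

Lemma hermitianB (R : realType) n (A B : 'M[R[i]]_n) :
  is_hermitian A -> is_hermitian B -> is_hermitian (A - B).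
Proof.
by rewrite /is_hermitian /ctr => HA HB; rewrite linearB/= map_mxB/= HA HB.
Qed.

(** Nonnegativity in the complex order includes a vanishing imaginary part, which holds for the
    Hermitian difference. *)
Lemma loewner_le_Re (R : realType) n (A B : 'M[R[i]]_n) :
  is_hermitian A -> is_hermitian B ->
  (forall z : 'cV[R[i]]_n, complex.Re (sesq z A z) <= complex.Re (sesq z B z)) ->
  loewner_le A B.
Proof.
move=> HA HB le z; rewrite lecE Im_sesq_hermitian; last exact: hermitianB.
rewrite eqxx/= /sesq mulmxBr mulmxBl !mxE -/(sesq z A z).
move: (le z); rewrite /sesq !mxE; move: (\sum_j _) (\sum_j _) => [a b] [a' b'] /=.
lra.
Qed.

(** * The good event *)

(** [b0] selects real or imaginary parts, the other half of the family receiving coefficient 0. The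
    factor 4 is the square of the largest [upper_coef]. *)
Lemma upper_family_mgf_le d (T : measurableType d) (R : realType)
    (P : probability T R) n (F : 'I_n * 'I_n * bool -> T -> R) (K : R) (b0 : bool) :
  0 <= K ->
  mutually_independent P
    (fun t : 'I_n * 'I_n * bool => (t.1.1 <= t.1.2)%N) F ->
  (forall t, measurable_fun setT (F t)) ->
  (forall t : 'I_n * 'I_n * bool, (t.1.1 <= t.1.2)%N -> forall a : R,
    (\int[P]_w (expR (a * F t w))%:E <= (expR (K * a ^+ 2))%:E)%E) ->
  forall a : 'I_n -> 'I_n -> R,
  (\int[P]_w (expR (\sum_i \sum_j a i j * (upper_coef R n i j * F (i, j, b0) w)))%:E <=
    (expR (4 * K * \sum_i \sum_j a i j ^+ 2))%:E)%E.
Proof.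
move=> K0 ind mF HK a.
pose D : {pred 'I_n * 'I_n * bool} := fun t => (t.1.1 <= t.1.2)%N.
pose b (t : 'I_n * 'I_n * bool) :=
  if t.2 == b0 then a t.1.1 t.1.2 * upper_coef R n t.1.1 t.1.2 else 0.
have sum3 (f : 'I_n * 'I_n * bool -> R) :
    \sum_(t in D) f t = \sum_(i < n) \sum_(j < n)
      (if (i <= j)%N then f (i, j, true) + f (i, j, false) else 0).
  rewrite big_mkcond/= pair_bigA/=.
  rewrite (eq_bigr (fun p : 'I_n * 'I_n => \sum_c
      (if (p.1 <= p.2)%N then f (p, c) else 0))); last first.
    by move=> [i j] _; rewrite big_bool/=; case: ifP => _; rewrite ?addr0.
  rewrite pair_bigA/=; apply: eq_bigr => -[[i j] c] _ /=.
  by [].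
have E1 w : \sum_i \sum_j a i j * (upper_coef R n i j * F (i, j, b0) w) =
    \sum_(t in D) b t * F t w.
  rewrite sum3; apply: eq_bigr => i _; apply: eq_bigr => j _; rewrite /b/=.
  case: leqP => ij; first by case: (b0) => /=; ring.
  rewrite /upper_coef ltnNge (ltnW ij) /= -val_eqE/= gtn_eqF//; ring.
under eq_integral do rewrite E1.
apply: le_trans (mutually_independent_mgf_le _ _ _ _ _ _ _ _ ind mF HK b) _.
rewrite lee_fin ler_expR (mulrC 4) -mulrA ler_wpM2l//.
rewrite -[X in X <= _]/(\sum_(t in D) b t ^+ 2) sum3 mulr_sumr.
apply: ler_sum => i _; rewrite mulr_sumr; apply: ler_sum => j _.
have a0 : 0 <= a i j ^+ 2 by exact: sqr_ge0.
case: ifP => _; last by rewrite mulr_ge0.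
have -> : b (i, j, true) ^+ 2 + b (i, j, false) ^+ 2 = a i j ^+ 2 * upper_coef R n i j ^+ 2.
  by rewrite /b /=; case: (b0) => /=; rewrite expr0n/=; ring.
rewrite mulrC ler_wpM2r// /upper_coef; case: ifP => _; last case: ifP => _.
- by rewrite expr2; lra.
- by rewrite expr1n; lra.
- by rewrite expr0n/=.
Qed.

Lemma markov_event d (T : measurableType d) (R : realType) (P : probability T R)
    (Z : T -> R) (a m : R) :
  measurable_fun setT Z -> (forall w, 0 <= Z w) -> 0 < a ->
  (\int[P]_w (Z w)%:E <= m%:E)%E ->
  measurable [set w | Z w <= a] /\
  ((1 - m / a)%:E <= P [set w | (Z w <= a)%R])%E.
Proof.
move=> mZ Z0 a0 IZ.
have mA : measurable [set w | Z w <= a].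
  have mI : measurable (`]-oo, a] : set R) by exact: measurable_itv.
  have <- : Z @^-1` `]-oo, a] = [set w | Z w <= a].
    by apply/seteqP; split => w /=; rewrite in_itv.
  by rewrite -[X in measurable X]setTI; exact: mZ.
split => //.
set A := [set w | Z w <= a].
have mAC : measurable (~` A) by exact: measurableC.
have H : (a%:E * P (~` A) <= m%:E)%E.
  apply: (@le_trans _ _ (\int[P]_w (a%:E * (\1_(~` A) w)%:E))%E).
    rewrite ge0_integralZl_EFin//; [|by apply/measurable_EFinP|exact: ltW].
    by rewrite integral_indic// setIT.
  apply: le_trans IZ; apply: ge0_le_integral => //.
  - by move=> w _; rewrite -EFinM lee_fin mulr_ge0// ltW.
  - by apply/measurable_EFinP; apply: measurable_funM.
  - by apply/measurable_EFinP.
  move=> w _; rewrite -EFinM lee_fin indicE.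
  have [/[!inE] Aw|_] := boolP (w \in ~` A); last by rewrite mulr0.
  by rewrite mulr1 leNgt; apply/negP => /ltW.
have PA : P A = (fine (P A))%:E by rewrite fineK// fin_num_measure.
move: H; rewrite probability_setC// PA -EFinB -EFinM !lee_fin => H.
by rewrite lerBlDr -lerBlDl ler_pdivlMr// mulrC.
Qed.

(** A level is named by one of its elements, so pairs of levels are indexed by n^2 pairs, whatever
    values [lev] takes; repetitions are harmless. *)
Definition level_set n (lev : 'I_n -> nat) (i : 'I_n) : {set 'I_n} :=
  [set k | lev k == lev i]%SET.

Definition level_sum (R : realType) n (K : R) (lev : 'I_n -> nat)
    (xi : 'I_n -> 'I_n -> R) (i j : 'I_n) : R :=
  lattice_sum R n n.+1 K (block_scale R n (level_set n lev i) (level_set n lev j))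
    (level_set n lev i) (level_set n lev j) xi.

Lemma bilin_le_of_level_sum (R : realType) n (K W kappa : R) (lev : 'I_n -> nat)
    (w : 'I_n -> R) xi (x y : 'I_n -> R) :
  (2 <= n)%N -> 0 <= K -> 0 <= kappa -> 0 <= W -> W <= \sum_i w i ->
  ln n%:R * W * \sum_i w i <= kappa ^+ 2 ->
  (forall i, 0 < w i) ->
  (forall i, w i <= W * 2^-1 ^+ lev i /\ W * 2^-1 ^+ lev i <= 2 * w i) ->
  (forall i j, level_sum R n K lev xi i j <= n%:R ^+ 6) ->
  bilin R n xi x y <= 10 * (16 * K + 6) * kappa * (wnorm R n w x * wnorm R n w y).
Proof.
move=> n2 K0 k0 W0 WS Hk w0 Hlev HZ.
have l4 := ln_ge_quarter R n n2.
have n0 : (0 < n)%N by exact: leq_trans n2.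
have B0 : 0 <= 16 * K + 6 by rewrite addr_ge0// mulr_ge0.
apply: (bilin_le_wnorm R n lev w W (16 * K + 6) (ln n%:R)) => //.
move=> l m x' y' xS yS.
have rhs0 (a b c : R) : 0 <= (16 * K + 6) * (Num.sqrt a * (Num.sqrt b * Num.sqrt c)).
  by rewrite !mulr_ge0 ?sqrtr_ge0.
(* An empty level has no representative, but it forces the vector to vanish. *)
have [/existsP[i /eqP li]|] := boolP [exists i, lev i == l]; last first.
  rewrite negb_exists => /forallP h; rewrite bilin0l// => i.
  by apply: xS; rewrite inE.
have [/existsP[j /eqP lj]|] := boolP [exists i, lev i == m]; last first.
  rewrite negb_exists => /forallP h; rewrite bilin0r// => k.
  by apply: yS; rewrite inE.
rewrite -li -lj in xS yS *.
exact: (bilin_block_le _ _ _ _ _ _ _ _ K0 n0 xS yS (HZ i j)).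
Qed.

Lemma wnorm_ge0 (R : realType) n (w x : 'I_n -> R) : 0 <= wnorm R n w x.
Proof. exact: sqrtr_ge0. Qed.

Lemma Re_sesq_Dmu_wnorm (R : realType) n (z : 'cV[R[i]]_n) (mu : 'I_n -> R) :
  (forall i, 0 < mu i) ->
  complex.Re (sesq z (Dmu mu) z) =
    wnorm R n (fun i => (mu i)^-1) (fun i => complex.Re (z i 0)) ^+ 2 +
    wnorm R n (fun i => (mu i)^-1) (fun i => complex.Im (z i 0)) ^+ 2.
Proof.
move=> mu0; rewrite Re_sesq_Dmu /wnorm !sqr_sqrtr; last 2 first.
- by apply: sumr_ge0 => i _; rewrite invrK mulr_ge0 ?sqr_ge0// ltW.
- by apply: sumr_ge0 => i _; rewrite invrK mulr_ge0 ?sqr_ge0// ltW.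
rewrite -big_split/=; apply: eq_bigr => i _; rewrite !invrK; ring.
Qed.

(** With A and A' the weighted norms of the real and imaginary parts, the four forms sum to at most
    (A + A')^2 / 4 <= (A^2 + A'^2) / 2. *)
Lemma hermitian_form_le_half (R : realType) n (mu : 'I_n -> R) (A : 'M[R[i]]_n)
    (z : 'cV[R[i]]_n) (w := fun i => (mu i)^-1) :
  (forall i, 0 < mu i) -> is_hermitian A ->
  (forall x y, bilin R n (fun i j => upper_coef R n i j * complex.Re (A i j)) x y <=
     4^-1 * (wnorm R n w x * wnorm R n w y)) ->
  (forall x y, bilin R n (fun i j => upper_coef R n i j * complex.Im (A i j)) x y <=
     4^-1 * (wnorm R n w x * wnorm R n w y)) ->
  complex.Re (sesq z A z) <= 2^-1 * complex.Re (sesq z (Dmu mu) z).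
Proof.
move=> mu0 HA Hre Him; rewrite Re_sesq_hermitian// Re_sesq_Dmu_wnorm// -/w.
set x := fun i => complex.Re _; set y := fun i => complex.Im _.
have h1 := Hre x x; have h2 := Hre y y; have h3 := Him y x.
have h4 := Him (fun i => -1 * x i) (fun j => 1 * y j).
have E1 : wnorm R n w (fun i => -1 * x i) = wnorm R n w x.
  by rewrite /wnorm; congr Num.sqrt; apply: eq_bigr => i _; rewrite mulN1r sqrrN.
have E2 : wnorm R n w (fun i => 1 * y i) = wnorm R n w y.
  by rewrite /wnorm; congr Num.sqrt; apply: eq_bigr => i _; rewrite mul1r.
rewrite E1 E2 in h4.
have : 0 <= (wnorm R n w x - wnorm R n w y) ^+ 2 by exact: sqr_ge0.
lra.
Qed.

Lemma sum_norm_le_wnorm (R : realType) n (w x : 'I_n -> R) : (forall i, 0 < w i) ->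
  \sum_i `|x i| <= Num.sqrt (\sum_i w i) * wnorm R n w x.
Proof.
move=> w0; have := sum_cauchy_schwarz R _ (fun i => Num.sqrt (w i))
  (fun i => `|x i| / Num.sqrt (w i)).
rewrite (eq_bigr (fun i => `|x i|)); last first.
  by move=> i _; rewrite mulrC divfK// gt_eqF// sqrtr_gt0.
move/le_trans; apply; rewrite /wnorm le_eqVlt; apply/orP; left; apply/eqP.
congr (Num.sqrt _ * Num.sqrt _); apply: eq_bigr => i _.
  by rewrite sqr_sqrtr// ltW.
by rewrite exprMn exprVn sqr_sqrtr ?(ltW (w0 i))// real_normK// num_real.
Qed.

(** With Q the form of [D_mu] at z and S = sum w, the norm of z is at most [sqrt (W Q)] and the
    inner product at most [2 sqrt (G S Q)]; the smallness hypothesis makes [sqrt (G W S)] at most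
    1/4. *)
Lemma linear_term_le_half (R : realType) n (mu : 'I_n -> R) (g z : 'cV[R[i]]_n)
    (W G tau : R) (w := fun i => (mu i)^-1) :
  (forall i, 0 < mu i) -> (forall i, w i <= W) -> 0 <= W -> 0 <= G ->
  (forall j, complex.Re (g j 0) ^+ 2 <= G) -> (forall j, complex.Im (g j 0) ^+ 2 <= G) ->
  0 <= tau <= 1 -> G * (W * \sum_i w i) <= 16^-1 ->
  tau * norm2 z * complex.Re ((ctr g *m z) 0 0) <=
    2^-1 * complex.Re (sesq z (Dmu mu) z).
Proof.
move=> mu0 wW W0 G0 gre gim /andP[t0 t1] Hsmall.
have w0 i : 0 < w i by rewrite invr_gt0.
rewrite Re_sesq_Dmu_wnorm// -/w.
pose x i := complex.Re (z i 0); pose y i := complex.Im (z i 0).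
set A := wnorm R n w _; set A' := wnorm R n w _.
have A0 : 0 <= A := wnorm_ge0 _ _ _ _.
have A'0 : 0 <= A' := wnorm_ge0 _ _ _ _.
pose Q := A ^+ 2 + A' ^+ 2.
have Q0 : 0 <= Q by rewrite addr_ge0// sqr_ge0.
have nz : norm2 z <= Num.sqrt W * Num.sqrt Q.
  rewrite -sqrtrM// /norm2 ler_wsqrtr// /Q /A /A' /wnorm !sqr_sqrtr; last 2 first.
  - by apply: sumr_ge0 => i _; rewrite divr_ge0 ?sqr_ge0// ltW.
  - by apply: sumr_ge0 => i _; rewrite divr_ge0 ?sqr_ge0// ltW.
  rewrite -big_split mulr_sumr; apply: ler_sum => i _ /=.
  rewrite -mulrDl mulrA ler_pdivlMr// mulrC ler_wpM2r//.
  by rewrite addr_ge0 ?sqr_ge0.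
have sG := sqrtr_ge0 G.
have norm_le (a : R) : a ^+ 2 <= G -> `|a| <= Num.sqrt G.
  by move=> h; rewrite -sqrtr_sqr ler_wsqrtr.
set S := \sum_i w i in Hsmall.
have S0 : 0 <= S by apply: sumr_ge0 => i _; exact: ltW.
have Rez : complex.Re ((ctr g *m z) 0 0) <= Num.sqrt G * (Num.sqrt S * (A + A')).
  have -> : complex.Re ((ctr g *m z) 0 0) =
      \sum_i (complex.Re (g i 0) * x i + complex.Im (g i 0) * y i).
    rewrite mxE Re_sum; apply: eq_bigr => i _; rewrite /ctr !mxE /x /y.
    by case: (g i 0) (z i 0) => [a b] [c d] /=; ring.
  apply: (@le_trans _ _ (Num.sqrt G * (\sum_i `|x i| + \sum_i `|y i|))).
    rewrite -big_split mulr_sumr; apply: ler_sum => i _ /=.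
    rewrite mulrDr; apply: lerD.
      apply: le_trans (ler_norm _) _; rewrite normrM ler_wpM2r//; exact: norm_le.
    apply: le_trans (ler_norm _) _; rewrite normrM ler_wpM2r//; exact: norm_le.
  rewrite ler_wpM2l// mulrDr; apply: lerD; exact: sum_norm_le_wnorm.
have n0 : 0 <= norm2 z by exact: sqrtr_ge0.
have AA : A + A' <= 2 * Num.sqrt Q.
  have h1 : A <= Num.sqrt Q.
    by rewrite -[leLHS](ger0_norm A0) -sqrtr_sqr ler_wsqrtr// lerDl sqr_ge0.
  have h2 : A' <= Num.sqrt Q.
    by rewrite -[leLHS](ger0_norm A'0) -sqrtr_sqr ler_wsqrtr// lerDr sqr_ge0.
  lra.
set r := Num.sqrt G * (Num.sqrt S * (A + A')) in Rez.
have r0 : 0 <= r by rewrite !mulr_ge0 ?sqrtr_ge0// addr_ge0.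
apply: (@le_trans _ _ (norm2 z * r)).
  apply: (@le_trans _ _ (tau * norm2 z * r)); first by rewrite ler_wpM2l// mulr_ge0.
  by rewrite ler_wpM2r// ler_piMl.
have sW := sqrtr_ge0 W; have sS := sqrtr_ge0 S; have sQ := sqrtr_ge0 Q.
apply: (@le_trans _ _ ((Num.sqrt W * Num.sqrt Q) *
    (Num.sqrt G * (Num.sqrt S * (2 * Num.sqrt Q))))).
  apply: ler_pM => //; rewrite ler_wpM2l// ler_wpM2l//.
have k4 : Num.sqrt G * Num.sqrt W * Num.sqrt S <= 4^-1.
  rewrite -(@ler_pXn2r _ 2)// ?nnegrE ?mulr_ge0// !exprMn !sqr_sqrtr//.
  by rewrite -mulrA; apply: le_trans Hsmall _; lra.
have QQ : Q = Num.sqrt Q * Num.sqrt Q by rewrite -expr2 sqr_sqrtr.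
have -> : Num.sqrt W * Num.sqrt Q * (Num.sqrt G * (Num.sqrt S * (2 * Num.sqrt Q))) =
    2 * ((Num.sqrt G * Num.sqrt W * Num.sqrt S) * (Num.sqrt Q * Num.sqrt Q)) by ring.
rewrite -QQ -/Q.
have : (Num.sqrt G * Num.sqrt W * Num.sqrt S) * Q <= 4^-1 * Q by rewrite ler_wpM2r.
lra.
Qed.

Lemma expectation_family_event d (T : measurableType d) (R : realType)
    (P : probability T R) (I : finType) (h : I -> T -> R) (m a : R) :
  (forall k, measurable_fun setT (h k)) -> (forall k w, 0 <= h k w) ->
  (forall k, (\int[P]_w (h k w)%:E <= m%:E)%E) -> 0 < a ->
  exists E : set T, [/\ measurable E, (forall w, E w -> forall k, h k w <= a) &
    ((1 - #|I|%:R * m / a)%:E <= P E)%E].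
Proof.
move=> mh h0 Ih a0.
have mZ : measurable_fun setT (fun w => \sum_k h k w) by exact: measurable_sum.
have IZ : (\int[P]_w (\sum_k h k w)%:E <= (#|I|%:R * m)%:E)%E.
  under eq_integral do rewrite -sumEFin.
  rewrite ge0_integral_sum//;
    [|by move=> k; apply/measurable_EFinP|by move=> k w _; rewrite lee_fin].
  apply: (@le_trans _ _ (\sum_(k : I) m%:E)%E); first exact: lee_sum.
  by rewrite sumEFin sumr_const mulr_natl.
have [mE PE] := markov_event _ _ _ P _ a _ mZ (fun w => sumr_ge0 _ (fun k _ => h0 k w)) a0 IZ.
exists [set w | \sum_k h k w <= a]; split => // w /= Ew k.
by apply: le_trans Ew; rewrite (bigD1 k)//= lerDl; apply: sumr_ge0.
Qed.

(** [K] is the constant 3 / c of [mgf_le] times the 4 of [upper_family_mgf_le]. [kappa] solves 10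
    (16 K + 6) kappa = 1/4, and is halved in the assumption because the budget returns (2 c)^2. The
    event is chosen before [tau]. *)
Lemma random_hermitian_event d (T : measurableType d) (R : realType)
    (P : probability T R) n (mu : 'I_n -> R) (X : T -> 'M[R[i]]_n)
    (g : T -> 'cV[R[i]]_n) (c := psi2_rate R) (K := 4 * (3 / psi2_rate R))
    (kappa := (40 * (16 * K + 6))^-1) :
  (2 <= n)%N -> (forall i, 0 < mu i) -> assumption2 (kappa / 2) mu ->
  (forall w, is_hermitian (X w)) ->
  (forall j k, measurable_fun setT (fun w => complex.Re (X w j k))) ->
  (forall j k, measurable_fun setT (fun w => complex.Im (X w j k))) ->
  mutually_independent P
    (fun jkb : 'I_n * 'I_n * bool => (jkb.1.1 <= jkb.1.2)%N)
    (fun jkb w => if jkb.2 then complex.Re (X w jkb.1.1 jkb.1.2)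
                  else complex.Im (X w jkb.1.1 jkb.1.2)) ->
  (forall j k : 'I_n, (j <= k)%N ->
     ('E_P[fun w => complex.Re (X w j k)] = 0)%E /\
     ('E_P[fun w => complex.Im (X w j k)] = 0)%E) ->
  (forall j k : 'I_n, (j <= k)%N ->
     (psi2norm P (fun w => complex.Re (X w j k)) <= 1)%E /\
     (psi2norm P (fun w => complex.Im (X w j k)) <= 1)%E) ->
  (forall j, measurable_fun setT (fun w => complex.Re (g w j ord0))) ->
  (forall j, measurable_fun setT (fun w => complex.Im (g w j ord0))) ->
  (forall j : 'I_n,
     (psi2norm P (fun w => complex.Re (g w j ord0)) <= 1)%E /\
     (psi2norm P (fun w => complex.Im (g w j ord0)) <= 1)%E) ->
  exists E : set T, [/\ measurable E,
    forall w, E w -> forall z : 'cV[R[i]]_n,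
      complex.Re (sesq z (X w) z) <= 2^-1 * complex.Re (sesq z (Dmu mu) z) /\
      (forall tau, 0 <= tau <= 1 ->
        tau * norm2 z * complex.Re ((ctr (g w) *m z) 0 0) <=
          2^-1 * complex.Re (sesq z (Dmu mu) z)) &
    ((1 - 6 * (n%:R ^- 4))%:E <= P E)%E].
Proof.
move=> n2 mu0 hyp HX mRe mIm indX EX psiX mgRe mgIm psig.
have c0 : 0 < c := psi2_rate_gt0 R.
have n0 : (0 < n)%N by exact: leq_trans n2.
have nR : 0 < n%:R :> R by rewrite ltr0n.
have K0 : 0 < K by rewrite mulr_gt0// divr_gt0.
have B0 : 0 < 16 * K + 6 by rewrite addr_gt0// mulr_gt0.
have k0 : 0 < kappa by rewrite invr_gt0 mulr_gt0.
have kB : 10 * (16 * K + 6) * kappa = 4^-1.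
  by rewrite /kappa; field; rewrite gt_eqF.
have [W [wW W0 WS]] := assumption2_budget R n (kappa / 2) mu n2
  (divr_ge0 (ltW k0) (ler0n _ _)) mu0 hyp.
have -> : 2 * (kappa / 2) = kappa by field.
move=> Hk; pose w i := (mu i)^-1.
have w0 i : 0 < w i by rewrite invr_gt0.
have /choice[lev Hlev] i : exists l : nat,
    w i <= W * 2^-1 ^+ l /\ W * 2^-1 ^+ l <= 2 * w i.
  exact: (dyadic_level R (w i) W (w0 i) (wW i)).
pose F (t : 'I_n * 'I_n * bool) v := if t.2 then complex.Re (X v t.1.1 t.1.2)
                  else complex.Im (X v t.1.1 t.1.2).
have mF t : measurable_fun setT (F t) by rewrite /F; case: t.2.
pose xi b v i j := upper_coef R n i j * F (i, j, b) v.
have mxi b i j : measurable_fun setT (fun v => xi b v i j).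
  by apply: measurable_funM => //; exact: mF.
have mgfF (t : 'I_n * 'I_n * bool) : (t.1.1 <= t.1.2)%N -> forall a : R,
    (\int[P]_v (expR (a * F t v))%:E <= (expR (3 / c * a ^+ 2))%:E)%E.
  case: t => -[i j] b /= ij a.
  have [E1 E2] := EX _ _ ij; have [p1 p2] := psiX _ _ ij.
  apply: (mgf_le _ _ _ P (F (i, j, b)) c c0 (mF _)).
    by rewrite /F; case: b.
  apply: (psi2norm_expR_sqr _ _ _ P _ (mF _)).
  by rewrite /F; case: b.
have K30 : 0 <= 3 / c by rewrite divr_ge0// ltW.
have mgfxi b := upper_family_mgf_le _ _ _ P n F (3 / c) b K30 indX mF mgfF.
have level b i j := lattice_sum_expectation _ _ _ P n n.+1 K
   (block_scale R n (level_set n lev i) (level_set n lev j))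
   (level_set n lev i) (level_set n lev j) (xi b) (mxi b) (mgfxi b).
pose e (u : R) := expR (c * u ^+ 2).
(* A single index set for everything, with expectation at most 1 + 1 + 2 + 2. Each entry of [g] is
   repeated n times, which the threshold n^6 affords. *)
pose h (k : 'I_n * 'I_n) v :=
  level_sum R n K lev (xi true v) k.1 k.2 + level_sum R n K lev (xi false v) k.1 k.2 +
  (e (complex.Re (g v k.2 ord0)) + e (complex.Im (g v k.2 ord0))).
have ls0 b v i j : 0 <= level_sum R n K lev (xi b v) i j by exact: lattice_sum_ge0.
have e0 u : 0 <= e u by exact: expR_ge0.
have me (f : T -> R) : measurable_fun setT f -> measurable_fun setT (fun v => e (f v)).
  move=> mf; rewrite /e; apply: measurableT_comp => //.
  by apply: measurable_funM => //; exact: measurable_funX.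
have mls b i j : measurable_fun setT (fun v => level_sum R n K lev (xi b v) i j).
  by have [] := level b i j.
have mh k : measurable_fun setT (h k).
  by apply: measurable_funD; apply: measurable_funD => //; apply: me.
have h0 k v : 0 <= h k v by rewrite /h !addr_ge0.
have Ih k : (\int[P]_v (h k v)%:E <= 6%:E)%E.
  have int_add (f1 f2 : T -> R) (m1 m2 : R) : measurable_fun setT f1 -> measurable_fun setT f2 ->
      (forall v, 0 <= f1 v) -> (forall v, 0 <= f2 v) ->
      (\int[P]_v (f1 v)%:E <= m1%:E)%E -> (\int[P]_v (f2 v)%:E <= m2%:E)%E ->
      (\int[P]_v (f1 v + f2 v)%:E <= (m1 + m2)%:E)%E.
    move=> mf1 mf2 f10 f20 I1 I2; under eq_integral do rewrite EFinD.
    rewrite ge0_integralD//; first by rewrite EFinD leeD.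
    - by move=> v _; rewrite lee_fin.
    - by apply/measurable_EFinP.
    - by move=> v _; rewrite lee_fin.
    - by apply/measurable_EFinP.
  have [p1 p2] := psig k.2.
  have -> : 6 = (1 + 1) + (2 + 2) :> R by ring.
  apply: (int_add _ _ (1 + 1) (2 + 2)).
  - exact: measurable_funD.
  - by apply: measurable_funD; apply: me.
  - by move=> v; rewrite addr_ge0.
  - by move=> v; rewrite addr_ge0.
  - have [_ l1] := level true k.1 k.2; have [_ l2] := level false k.1 k.2.
    exact: (int_add _ _ 1 1 (mls true k.1 k.2) (mls false k.1 k.2)
      (fun v => ls0 true v _ _) (fun v => ls0 false v _ _) l1 l2).
  - have i1 := psi2norm_expR_sqr _ _ _ P _ (mgRe k.2) p1.
    have i2 := psi2norm_expR_sqr _ _ _ P _ (mgIm k.2) p2.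
    exact: (int_add _ _ 2 2 (me _ (mgRe k.2)) (me _ (mgIm k.2))
      (fun v => e0 _) (fun v => e0 _) i1 i2).
have n6 : 0 < n%:R ^+ 6 :> R by exact: exprn_gt0.
have [E [mE HE PE]] := expectation_family_event _ _ _ P _ h 6 (n%:R ^+ 6) mh h0 Ih n6.
exists E; split => //; last first.
  apply: le_trans PE; rewrite lee_fin card_prod card_ord natrM.
  rewrite le_eqVlt; apply/orP; left; apply/eqP.
  by field; rewrite gt_eqF.
move=> v Ev z.
have hle k := HE v Ev k.
have lsle b i j : level_sum R n K lev (xi b v) i j <= n%:R ^+ 6.
  apply: le_trans (hle (i, j)); rewrite /h /=.
  have := ls0 true v i j; have := ls0 false v i j.
  have := e0 (complex.Re (g v j ord0)); have := e0 (complex.Im (g v j ord0)).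
  by case: b; lra.
have bl b x y := bilin_le_of_level_sum R n K W kappa lev w (xi b v) x y n2 (ltW K0)
  (ltW k0) W0 WS Hk w0 Hlev (lsle b).
rewrite kB in bl.
split; first by apply: hermitian_form_le_half => // x y; [exact: (bl true)|exact: (bl false)].
move=> tau tau01.
have l0 : 0 <= ln n%:R :> R by rewrite ln_ge0// ler1n.
(* On the event exp (c u^2) <= n^6 for every real or imaginary part u of an entry of [g], that is,
   u^2 <= 6 log n / c. *)
apply: (linear_term_le_half R n mu (g v) z W (6 * ln n%:R / c) tau) => //.
- by rewrite divr_ge0 ?mulr_ge0// ltW.
- move=> j; rewrite ler_pdivlMr// -ler_expR expRM_natl lnK ?posrE//.
  apply: le_trans (hle (j, j)); rewrite /h /= mulrC -/(e _).
  have := ls0 true v j j; have := ls0 false v j j.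
  have := e0 (complex.Im (g v j ord0)); lra.
- move=> j; rewrite ler_pdivlMr// -ler_expR expRM_natl lnK ?posrE//.
  apply: le_trans (hle (j, j)); rewrite /h /= mulrC -/(e _).
  have := ls0 true v j j; have := ls0 false v j j.
  have := e0 (complex.Re (g v j ord0)); lra.
have -> : 6 * ln n%:R / c * (W * \sum_i (mu i)^-1) =
    6 / c * (ln n%:R * W * \sum_i (mu i)^-1) by ring.
apply: (@le_trans _ _ (6 / c * kappa ^+ 2)).
  by rewrite ler_wpM2l// divr_ge0// ltW.
have E1 : 40 * (16 * K + 6) * kappa = 1 by rewrite mulfV// gt_eqF// mulr_gt0.
(* For q = 6 / c the definition of [kappa] reads 40 (32 q + 6) kappa = 1, so q kappa and kappa are
   both below 1/4 and their product is at most 1/16. *)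
have KE : K = 2 * (6 / c) by rewrite /K -/c; field; rewrite gt_eqF.
rewrite KE in E1; have c60 : 0 <= 6 / c by rewrite divr_ge0// ltW.
move: (6 / c) c60 E1 => q q0 E1.
have : 0 <= q * kappa by rewrite mulr_ge0// ltW.
have := ltW k0; nra.
Qed.

Theorem theorem7 :
  forall R : realType,
  exists c0' : R, 0 < c0' /\
  exists C : R, 0 < C /\
  forall (n : nat), (2 <= n)%N ->
  forall mu : 'I_n -> R, (forall i, 0 < mu i) -> assumption2 c0' mu ->
  forall (d : measure_display) (T : measurableType d) (P : probability T R)
    (X : T -> 'M[R[i]]_n) (g : T -> 'cV[R[i]]_n) (tau : R),
  (* X is a random Hermitian matrix *)
  (forall w, is_hermitian (X w)) ->
  (forall j k, measurable_fun setT (fun w => complex.Re (X w j k))) ->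
  (forall j k, measurable_fun setT (fun w => complex.Im (X w j k))) ->
  (* {Re X_jk, Im X_jk}_{j <= k} jointly independent *)
  mutually_independent P
    (fun jkb : 'I_n * 'I_n * bool => (jkb.1.1 <= jkb.1.2)%N)
    (fun jkb w => if jkb.2 then complex.Re (X w jkb.1.1 jkb.1.2)
                  else complex.Im (X w jkb.1.1 jkb.1.2)) ->
  (* centered *)
  (forall j k : 'I_n, (j <= k)%N ->
     ('E_P[fun w => complex.Re (X w j k)] = 0)%E /\
     ('E_P[fun w => complex.Im (X w j k)] = 0)%E) ->
  (* subgaussian norms at most 1 *)
  (forall j k : 'I_n, (j <= k)%N ->
     (psi2norm P (fun w => complex.Re (X w j k)) <= 1)%E /\
     (psi2norm P (fun w => complex.Im (X w j k)) <= 1)%E) ->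
  (* tau in [0, 1] *)
  0 <= tau <= 1 ->
  (* g : real and imaginary parts of entries measurable, jointly independent *)
  (forall j, measurable_fun setT (fun w => complex.Re (g w j ord0))) ->
  (forall j, measurable_fun setT (fun w => complex.Im (g w j ord0))) ->
  mutually_independent P (fun _ : 'I_n * bool => true)
    (fun jb w => if jb.2 then complex.Re (g w jb.1 ord0)
                 else complex.Im (g w jb.1 ord0)) ->
  (forall j : 'I_n,
     (psi2norm P (fun w => complex.Re (g w j ord0)) <= 1)%E /\
     (psi2norm P (fun w => complex.Im (g w j ord0)) <= 1)%E) ->
  (* g independent of X *)
  independent_families P
    (fun (jkb : 'I_n * 'I_n * bool) w =>
       if jkb.2 then complex.Re (X w jkb.1.1 jkb.1.2)
       else complex.Im (X w jkb.1.1 jkb.1.2))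
    (fun (jb : 'I_n * bool) w =>
       if jb.2 then complex.Re (g w jb.1 ord0) else complex.Im (g w jb.1 ord0)) ->
  (* conclusion: with probability 1 - O(n^-4) ... *)
  (exists E : set T, measurable E /\
     E `<=` [set w | forall z : 'cV[R[i]]_n,
               complex.Re (sesq z (X w) z)
               + tau * norm2 z * complex.Re ((ctr (g w) *m z) 0 0)
               <= complex.Re (sesq z (Dmu mu) z)] /\
     ((1 - C * (n%:R ^- 4))%:E <= P E)%E) /\
  (* ... and in particular X <= D_mu (Loewner order) with probability 1 - O(n^-4) *)
  (exists E : set T, measurable E /\
     E `<=` [set w | loewner_le (X w) (Dmu mu)] /\
     ((1 - C * (n%:R ^- 4))%:E <= P E)%E).
Proof.
move=> R.
set K : R := 4 * (3 / psi2_rate R).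
have K0 : 0 < K by rewrite mulr_gt0// divr_gt0// psi2_rate_gt0.
exists ((40 * (16 * K + 6))^-1 / 2); split.
  by rewrite divr_gt0// invr_gt0 mulr_gt0// addr_gt0// mulr_gt0.
exists 6; split => // n n2 mu mu0 hyp d T P X g tau HX mRe mIm indX EX psiX.
move=> tau01 mgRe mgIm _ psig _.
have [E [mE HE PE]] := random_hermitian_event _ _ _ P n mu X g n2 mu0 hyp
  HX mRe mIm indX EX psiX mgRe mgIm psig.
split; exists E; split => //; split => // w Ew /=.
  by move=> z; have [h1 /(_ tau tau01) h2] := HE w Ew z; lra.
apply: loewner_le_Re; [exact: HX|exact: Dmu_hermitian|].
move=> z; have [h _] := HE w Ew z; apply: le_trans h _.
have D0 : 0 <= complex.Re (sesq z (Dmu mu) z).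
  by rewrite Re_sesq_Dmu_wnorm// addr_ge0// sqr_ge0.
lra.
Qed.
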